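(* Let $k,n,r$ be positive integers with $4\le k<r$. Then \[ \mathrm{ex}_r(n,\mathcal{BC}_{\geq k})=\left\lfloor\frac{n-1}{r}\right\rfloor(k-1)+\mathbb{1}_{r\mathbb{N}^*}(n). \] Moreover, if $r\mid (n-1)$, then the only $n$-vertex $r$-graphs attaining this maximum are the $(r+1,k-1)$-block trees.
   Context: An $r$-graph is an $r$-uniform hypergraph; unless stated otherwise hypergraphs are simple (no repeated hyperedges). A Berge cycle of length $t$ in a hypergraph is an alternating sequence $v_0,e_1,v_1,e_2,\dots,v_{t-1},e_t,v_0$ of distinct vertices $v_0,\dots,v_{t-1}$ and distinct hyperedges $e_1,\dots,e_t$ with $v_{i-1},v_i\in e_i$ for all $i$ (indices mod $t$). $\mathcal{BC}_{\geq k}$ denotes the family of Berge cycles of length at least $k$. $\mathrm{ex}_r(n,\mathcal F)$ is the maximum number of hyperedges of an $n$-vertex $r$-graph containing no member of $\mathcal F$ as a sub-hypergraph. $\mathbb{1}_{r\mathbb{N}^*}(n)$ equals $1$ if $n$ is a positive multiple of $r$ and $0$ otherwise. The 2-shadow $\partial_2\mathcal H$ of a hypergraph $\mathcal H$ is the graph on $V(\mathcal H)$ whose edges are the pairs of vertices lying together in some hyperedge. For $s\in\{r,r+1\}$, an $r$-graph $\mathcal H$ is an $(s,k-1)$-block tree if $\partial_2\mathcal H$ is connected and every 2-connected block of $\partial_2\mathcal H$ consists of $s$ vertices which induce exactly $k-1$ hyperedges of $\mathcal H$. *)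

(* Defs.v *)
From mathcomp Require Import all_boot.

Set Implicit Arguments.
Unset Strict Implicit.
Unset Printing Implicit Defensive.

(* A simple hypergraph on the vertex set V is its set of
   hyperedges E : {set {set V}}. *)

Section Hypergraph.
Variable V : finType.
Implicit Types (E : {set {set V}}) (g : rel V) (A B : {set V}).

Definition is_rgraph (r : nat) E : bool := [forall (e | e \in E), #|e| == r].

(* The cycle v_0, e_1, v_1, ..., e_t, v_0 is encoded with its hyperedges shifted
   by one: e i stands for e_(i+1), and ordS is the successor modulo t. *)
Definition berge_cycle E (t : nat)
    (v : {ffun 'I_t -> V}) (e : {ffun 'I_t -> {set V}}) : bool :=
  [&& injectiveb v, injectiveb e &
      [forall i, [&& e i \in E, v i \in e i & v (ordS i) \in e i]]].

(* A Berge cycle has at most #|V| vertices, so bounding t loses nothing; see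
   BC_freeP. *)
Definition BC_free (k : nat) E : bool :=
  ~~ [exists t : 'I_#|V|.+1, (k <= t) &&
        [exists v : {ffun 'I_t -> V}, exists e : {ffun 'I_t -> {set V}},
           berge_cycle E v e]].

Lemma BC_freeP (k : nat) E :
  reflect (forall t (v : {ffun 'I_t -> V}) (e : {ffun 'I_t -> {set V}}),
             k <= t -> ~ berge_cycle E v e)
          (BC_free k E).
Proof.
apply: (iffP idP) => [fE t v e kt cyc|fE].
  have tV : t < #|V|.+1.
    have /and3P[/injectiveP vinj _ _] := cyc.
    by rewrite ltnS -[X in X <= _](card_ord t); exact: leq_card vinj.
  move/negP: fE; apply; apply/existsP; exists (Ordinal tV); rewrite /= kt.
  by apply/existsP; exists v; apply/existsP; exists e.
apply/negP => /existsP[t /andP[kt /existsP[v /existsP[e cyc]]]].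
exact: (fE t v e kt cyc).
Qed.

Definition shadow E : rel V :=
  fun x y => (x != y) && [exists (e | e \in E), (x \in e) && (y \in e)].

(* The subgraph of g induced by A is connected; the empty graph is not. *)
Definition connected_on g A : bool :=
  (A != set0) &&
  [forall (x | x \in A), forall (y | y \in A),
     connect [rel u v | [&& u \in A, v \in A & g u v]] x y].

(* In particular a 2-connected graph has at least three vertices. *)
Definition two_connected_on g A : bool :=
  [&& 2 < #|A|, connected_on g A &
      [forall (x | x \in A), connected_on g (A :\ x)]].

(* Blocks are induced subgraphs, hence determined by their vertex sets. *)
Definition two_connected_block g B : bool := maxset (two_connected_on g) B.

Definition block_tree (r s m : nat) E : bool :=
  [&& is_rgraph r E, connected_on (shadow E) setT &
      [forall (B | two_connected_block (shadow E) B),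
         (#|B| == s) && (#|[set e in E | e \subset B]| == m)]].

End Hypergraph.

(* ex_r(n, F), with F given by the predicate "contains no member of F". *)
Definition ex_uniform (r n : nat) (free : pred {set {set 'I_n}}) : nat :=
  \max_(E : {set {set 'I_n}} | is_rgraph r E && free E) #|E|.
Arguments ex_uniform : clear implicits.

Definition ind_pos_multiple (r n : nat) : nat := (0 < n) && (r %| n).

(* Main.v *)
Require Import Defs.
From mathcomp Require Import all_boot.
From mathcomp Require Import zify.
From Stdlib Require Import Classical.

(* Induction on the number of vertices: in a hypergraph without long Berge
   cycles, some r vertices meet at most k - 1 hyperedges, or some r - 1 vertices
   meet at most one.  These vertices come from a longest alternating sequence
   e_0, v_0, e_1, v_1, ...: with c = min(length, k - 1), a vertex y of e_0 which
   is none of v_0, ..., v_(c-1) lies only in e_0, ..., e_(c-1), for otherwise the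
   sequence could be extended or a long cycle closed, and Posa rotations produce
   enough vertices y.  In the extremal case r | n - 1 the r deleted vertices leave
   an extremal hypergraph, in which any two vertices are joined by a Berge path of
   length at least k - 1; hence the k - 1 deleted hyperedges can use only one of
   the remaining vertices, and the hypergraph is obtained by gluing blocks on
   r + 1 vertices one at a time. *)

Set Implicit Arguments.
Unset Strict Implicit.
Unset Printing Implicit Defensive.

(** Rotations only permute the first c hyperedges, so every vertex they bring to the front meets at
    most k - 1 hyperedges, and the matter is to count such vertices. Those of e_0 that are not
    joints number r minus the chords, a chord being a v_j in e_0. Each chord j > 0 pays for itself:
    either v_(j-1) can be freed, or e_j brings two new vertices. Chord 0 has no predecessor, so the
    count may stop at r - 1, one short of the goal. This is why a second alternative exists: near
    equality forces so much structure that r - 1 vertices of e_0 lie in no other hyperedge. Deleting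
    them costs one hyperedge, which the bound can afford, with slack when r | n - 1.

    The condition k >= 4 enters through blocks: a hyperedge in a block of r + 1 vertices misses one
    vertex, so among k - 1 >= 3 of them one contains any given pair. The condition k < r leaves room
    to choose distinct joints while running through all k - 1 of them.

    Conversely, the hyperedges of a Berge cycle span a 2-connected part of the shadow; hence absence
    of long cycles in block trees is mere counting inside blocks. *)

Lemma exists_max (P : nat -> Prop) (b i : nat) :
  P i -> (forall j, P j -> j <= b) ->
  exists2 m, P m & forall j, P j -> j <= m.
Proof.
move=> Pi Pb; move: {2}(b - i) (leqnn (b - i)) => d.
elim: d i Pi => [|d IHd] i Pi.
  by rewrite leqn0 subn_eq0 => bi; exists i => // j /Pb jb; exact: leq_trans bi.
(* [P] will assert the existence of functions on [nat], so it is not decidable as such; excluded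
   middle replaces a search. *)
move=> bid; have [[j Pj ij]|nP] := classic (exists2 j, P j & i < j).
  by apply: (IHd j) => //; have := Pb _ Pj; lia.
by exists i => // j Pj; rewrite leqNgt; apply/negP => ij; apply: nP; exists j.
Qed.

Lemma exists_subset_card (T : finType) (A : {set T}) n :
  n <= #|A| -> exists2 B : {set T}, B \subset A & #|B| = n.
Proof.
move=> nA; exists [set:: take n (enum A)].
  by apply/subsetP => x; rewrite inE => /mem_take; rewrite mem_enum.
rewrite cardsE (card_uniqP _) ?take_uniq ?enum_uniq // size_take -cardE.
by case: ltngtP nA.
Qed.

(** * Alternating sequences, the cycles they close, and their rotations *)

Section Semipaths.
Variable V : finType.
Implicit Types (E F : {set {set V}}) (A B S : {set V}).
Implicit Types (e : nat -> {set V}) (v x : nat -> V).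

Definition incident E S : {set {set V}} := [set h in E | ~~ [disjoint h & S]].

Lemma BC_free_sub k E F : F \subset E -> BC_free k E -> BC_free k F.
Proof.
move=> /subsetP FE /BC_freeP Ef; apply/BC_freeP => t v e kt /and3P[vi ei /forallP ve].
apply: (Ef t v e kt); rewrite /berge_cycle vi ei; apply/forallP => i.
by have /and3P[/FE -> -> ->] := ve i.
Qed.

(** Functions on [nat], read only below [t], let shifted and reversed pieces be spliced without
    casts between ordinals. *)
Lemma BC_free_no_cycle k E t x e :
  BC_free k E -> k <= t ->
  (forall i, i < t -> [/\ e i \in E, x i \in e i & x (i.+1 %% t) \in e i]) ->
  {in gtn t &, injective x} -> {in gtn t &, injective e} -> False.
Proof.
move=> /BC_freeP Ef kt xe xinj einj.
apply: (Ef t [ffun i : 'I_t => x i] [ffun i : 'I_t => e i] kt).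
apply/and3P; split.
- by apply/injectiveP => i j; rewrite !ffunE => /xinj ij; apply/val_inj/ij; exact: ltn_ord.
- by apply/injectiveP => i j; rewrite !ffunE => /einj ij; apply/val_inj/ij; exact: ltn_ord.
by apply/forallP => i; rewrite !ffunE /=; have [-> -> ->] := xe i (ltn_ord i).
Qed.

(* An alternating sequence e_0, v_0, e_1, v_1, ..., e_(m-1), v_(m-1) starting
   with a hyperedge; only the values below m matter. *)
Definition semipath E m e v : Prop :=
  [/\ forall i, i < m -> e i \in E /\ v i \in e i,
      forall i, i.+1 < m -> v i \in e i.+1,
      {in gtn m &, injective e} & {in gtn m &, injective v}].

Section NoLongCycle.
Variables (E : {set {set V}}) (k m : nat).
Hypothesis Ef : BC_free k E.

(** Otherwise [e 1], ..., [e i], [e 0] close a Berge cycle through [v 0], ..., [v i], of length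
    [i.+1]. *)
Lemma semipath_start_joint e v i :
  semipath E m e v -> i < m -> v i \in e 0 -> i.+1 < k.
Proof.
move=> [ev ve einj vinj] im vi0; rewrite ltnNge; apply/negP => ki.
apply: (@BC_free_no_cycle k E i.+1 v (fun l => if l < i then e l.+1 else e 0)) => //.
- move=> l; rewrite ltnS leq_eqVlt => /predU1P[->|li].
    by rewrite ltnn modnn vi0; have [-> ->] := ev 0 (leq_ltn_trans (leq0n i) im).
  rewrite li modn_small // ve ?(leq_ltn_trans _ im) //.
  by have [-> ->] := ev l.+1 (leq_ltn_trans li im).
- by move=> a b; rewrite !inE => ai bi; apply: vinj; rewrite !inE; lia.
move=> a b; rewrite !inE => ai bi.
by case: ltnP => ai'; case: ltnP => bi' => /einj; rewrite !inE; lia.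
Qed.

(** Otherwise [y], [e 0], [v 0], ..., [v i.-1], [e i] and back to [y] is a Berge cycle of length
    [i.+1]. *)
Lemma semipath_start_edge e v y i :
  semipath E m e v -> y \in e 0 -> (forall j, j < m -> y != v j) ->
  i < m -> y \in e i -> i.+1 < k.
Proof.
move=> [ev ve einj vinj] y0 yv im yi; rewrite ltnNge; apply/negP => ki.
apply: (@BC_free_no_cycle k E i.+1 (fun l => if l is l'.+1 then v l' else y) e) => //.
- move=> l; rewrite ltnS leq_eqVlt => /predU1P[->|li].
    rewrite modnn yi; have [-> _] := ev i im; split=> //.
    by case: i {ki yi} im => // i im; exact: ve.
  have lm := ltn_trans li im; rewrite modn_small //; have [-> ->] := ev l lm; split=> //.
  by case: l {li} lm => // l lm; exact: ve.
- move=> [|a] [|b]; rewrite !inE //.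
  + by move=> _ bi yb; have := yv b; rewrite yb eqxx => /(_ ltac:(lia)).
  + by move=> bi _ yb; have := yv a; rewrite yb eqxx => /(_ ltac:(lia)).
  by move=> ai bi /vinj; rewrite !inE => -> //; lia.
by move=> a b; rewrite !inE => ai bi; apply: einj; rewrite !inE; lia.
Qed.

End NoLongCycle.

Section Rotations.
Variables (E : {set {set V}}) (m : nat).

Lemma semipath_cons e v y h :
  semipath E m e v -> y \in e 0 -> (forall j, j < m -> y != v j) ->
  h \in E -> y \in h -> (forall j, j < m -> h != e j) ->
  semipath E m.+1 (fun l => if l is l'.+1 then e l' else h)
                  (fun l => if l is l'.+1 then v l' else y).
Proof.
move=> [ev ve einj vinj] y0 yv hE yh he; split.
- by move=> [|l] lm //; exact: ev.
- by move=> [|l] lm //; exact: ve.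
- move=> [|a] [|b]; rewrite !inE //.
  + by move=> _ bi yb; have := he b bi; rewrite yb eqxx.
  + by move=> bi _ yb; have := he a bi; rewrite yb eqxx.
  by move=> ai bi /einj ->.
- move=> [|a] [|b]; rewrite !inE //.
  + by move=> _ bi yb; have := yv b bi; rewrite yb eqxx.
  + by move=> bi _ yb; have := yv a bi; rewrite yb eqxx.
  by move=> ai bi /vinj ->.
Qed.

(** Rotation at a chord [v j \in e 0]: the sequence becomes e_j, v_(j-1), e_(j-1), ..., v_0, e_0,
    v_j, e_(j+1), ..., with the same hyperedges and joints but with e_j in front. *)
Definition rot_edge e j := fun i => if i <= j then e (j - i) else e i.
Definition rot_joint v j := fun i => if i < j then v (j - i.+1) else v i.

Lemma semipath_rot_edge e v j :
  semipath E m e v -> j < m -> v j \in e 0 ->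
  semipath E m (rot_edge e j) (rot_joint v j).
Proof.
move=> [ev ve einj vinj] jm vj0; rewrite /rot_edge /rot_joint; split.
- move=> i im; case: ltngtP => ij.
  + have [-> _] := ev (j - i) ltac:(lia); split=> //.
    by rewrite (_ : j - i = (j - i.+1).+1); [apply: ve|]; lia.
  + exact: ev.
  by rewrite ij subnn; have [-> _] := ev 0 ltac:(lia).
- move=> i im; case: ltngtP => ij //.
  + by have [_ ->] := ev (j - i.+1) ltac:(lia).
  + by apply: ve; lia.
  by apply: ve.
- move=> a b; rewrite !inE => am bm.
  by case: leqP => aj; case: leqP => bj /einj; rewrite !inE; lia.
move=> a b; rewrite !inE => am bm.
by case: ltnP => aj; case: ltnP => bj /vinj; rewrite !inE; lia.
Qed.

(** Here the fresh vertex [y] serves as the joint between [e 0] and [e j]. The hyperedge [e j.-1]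
    comes to the front and the joint [v j.-1] is released as a fresh vertex of it. *)
Lemma semipath_rot_vertex e v y j :
  semipath E m e v -> y \in e 0 -> (forall i, i < m -> y != v i) ->
  0 < j < m -> y \in e j ->
  let e' := rot_edge e j.-1 in
  let v' := fun i => if i < j.-1 then v (j.-1 - i.+1)
                     else if i == j.-1 then y else v i in
  [/\ semipath E m e' v', v j.-1 \in e' 0 & forall i, i < m -> v j.-1 != v' i].
Proof.
case: j => // j [ev ve einj vinj] y0 yv jm yj e' v'; rewrite /= in e' v' *; split.
- rewrite /e' /v' /rot_edge; split.
  + move=> i im; case: ltngtP => ij.
    * have [-> _] := ev (j - i) ltac:(lia); split=> //.
      by rewrite (_ : j - i = (j - i.+1).+1); [apply: ve|]; lia.
    * exact: ev.
    by rewrite ij subnn; have [-> _] := ev 0 ltac:(lia).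
  + move=> i im; case: ltngtP => ij //.
    * by have [_ ->] := ev (j - i.+1) ltac:(lia).
    * by apply: ve; lia.
    by rewrite ij.
  + move=> a b; rewrite !inE => am bm.
    by case: leqP => aj; case: leqP => bj /einj; rewrite !inE; lia.
  move=> a b; rewrite !inE => am bm.
  case: ltngtP => aj; case: ltngtP => bj; try by [move=> /vinj; rewrite !inE; lia | move=> _; lia].
  + by move=> yv'; have := yv (j - a.+1); rewrite yv' eqxx => /(_ ltac:(lia)).
  + by move=> yv'; have := yv a; rewrite yv' eqxx => /(_ ltac:(lia)).
  + by move=> yv'; have := yv (j - b.+1); rewrite yv' eqxx => /(_ ltac:(lia)).
  by move=> yv'; have := yv b; rewrite yv' eqxx => /(_ ltac:(lia)).
- by rewrite /e' /rot_edge /= subn0; have [_ ->] := ev j ltac:(lia).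
move=> i im; rewrite /v'; case: ltngtP => ij.
- by apply/eqP => /vinj; rewrite !inE; lia.
- by apply/eqP => /vinj; rewrite !inE; lia.
by rewrite eq_sym; apply: yv; lia.
Qed.

End Rotations.
End Semipaths.

Lemma leq_mul_card_bigcup (I T : finType) (D : {set I}) (B : I -> {set T}) n :
  (forall i, i \in D -> n <= #|B i|) ->
  {in D &, forall i j, i != j -> [disjoint B i & B j]} ->
  n * #|D| <= #|\bigcup_(i in D) B i|.
Proof.
elim: {D}#|D| {-2}D (leqnn #|D|) => [|d IHd] D Dd nB dB.
  by move: Dd; rewrite leqn0 => /eqP->; rewrite muln0.
have [->|[i iD]] := set_0Vmem D; first by rewrite cards0 muln0.
rewrite (big_setD1 i) //= (cardsD1 i D) iD mulnDr muln1.
rewrite cardsU disjoint_setI0 ?cards0 ?subn0.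
  apply: leq_add; first exact: nB.
  apply: IHd.
  - by move: Dd; rewrite (cardsD1 i D) iD.
  - by move=> j /setD1P[_ jD]; exact: nB.
  by move=> j l /setD1P[_ jD] /setD1P[_ lD]; exact: dB.
apply/bigcup_disjointP => j /setD1P[ji jD].
by rewrite disjoint_sym; apply: dB; rewrite // eq_sym.
Qed.

(** * A sparse vertex set extracted from a longest alternating sequence *)

Section SparseSet.
Variable V : finType.
Implicit Types (E F : {set {set V}}) (A B S : {set V}).
Implicit Types (e : nat -> {set V}) (v x : nat -> V).

Section LongestSemipath.
Variables (E F : {set {set V}}) (k r m : nat).
Hypotheses (Er : is_rgraph r E) (Ef : BC_free k E).
Hypotheses (k_gt1 : 1 < k) (k_lt_r : k < r) (m_gt0 : 0 < m).
Hypothesis m_max : forall e v, ~ semipath E m.+1 e v.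

Let c := minn m k.-1.

Definition joints v : {set V} := [set v i | i : 'I_c].
(** [F] will be the set of the first [c] hyperedges of one longest semipath, fixed once and for all:
    any confined vertices together meet at most [k.-1] hyperedges. *)
Definition confined : {set V} :=
  [set y in cover E | [forall (h | h \in E), (y \in h) ==> (h \in F)]].
Definition on_track e v := semipath E m e v /\ forall i, i < c -> e i \in F.
Definition chords e v : {set 'I_c} := [set i : 'I_c | v i \in e 0].

Lemma c_gt0 : 0 < c. Proof. rewrite /c; lia. Qed.
Lemma c_le_m : c <= m. Proof. exact: geq_minl. Qed.
Let ltcm i : i < c -> i < m. Proof. by move=> ic; exact: leq_trans ic c_le_m. Qed.

Lemma mem_joints v i : i < c -> v i \in joints v.
Proof. by move=> ic; apply/imsetP; exists (Ordinal ic). Qed.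

(** A joint in [e 0] has index below [k.-1] by [semipath_start_joint], hence below [c]; so avoiding
    the first [c] joints is avoiding all of them. *)
Lemma start_fresh e v y i :
  semipath E m e v -> y \in e 0 :\: joints v -> i < m -> y != v i.
Proof.
move=> P /setDP[y0 yW] im; apply: contra yW => /eqP yi.
rewrite yi mem_joints //; have := semipath_start_joint Ef P im.
by rewrite -yi => /(_ y0) ik; rewrite /c; lia.
Qed.

(** A hyperedge off the semipath could be prepended through [y], against the maximality of [m]; one
    on it has index below [c] by [semipath_start_edge]. *)
Lemma start_incident e v y h :
  semipath E m e v -> y \in e 0 :\: joints v -> h \in E -> y \in h ->
  exists2 i, i < c & h = e i.
Proof.
move=> P yN hE yh; have fresh := fun i => start_fresh P yN (i := i).
have y0 : y \in e 0 by case/setDP: yN.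
have [[i im hi]|nh] := classic (exists2 i, i < m & h = e i).
  exists i => //; rewrite hi in yh.
  by have := semipath_start_edge Ef P y0 fresh im yh; rewrite /c; lia.
case: (m_max (semipath_cons P y0 fresh hE yh _)) => j jm.
by apply/eqP => hj; apply: nh; exists j.
Qed.

Lemma start_confined e v y :
  on_track e v -> y \in e 0 :\: joints v -> y \in confined.
Proof.
move=> [P eF] yN; have y0 : y \in e 0 by case/setDP: yN.
rewrite inE; apply/andP; split.
  apply/bigcupP; exists (e 0) => //.
  by case: P => + _ _ _ => /(_ 0 m_gt0) [].
apply/forall_inP => h hE; apply/implyP => yh.
by have [i ic ->] := start_incident P yN hE yh; exact: eF.
Qed.

(** For [j < c] the rotation permutes positions below [c] only, so neither [F] nor the set of joints
    has to be updated. *)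
Lemma on_track_edge e v j :
  on_track e v -> j < c -> v j \in e 0 ->
  on_track (rot_edge e j) (rot_joint v j) /\ joints (rot_joint v j) = joints v.
Proof.
move=> [P eF] jc vj; split; first split.
- by apply: semipath_rot_edge => //; exact: ltcm.
- by move=> i ic; rewrite /rot_edge; case: ifP => _; apply: eF; lia.
have sub u : joints (rot_joint u j) \subset joints u.
  apply/subsetP => _ /imsetP[i _ ->]; rewrite /rot_joint.
  by case: ltnP => ij; apply: mem_joints => //; lia.
apply/eqP; rewrite eqEsubset sub /=.
apply/subsetP => _ /imsetP[i _ ->].
have [ij|ij] := ltnP i j.
  have -> : v i = rot_joint v j (j - i.+1).
    by rewrite /rot_joint; case: ltnP => ?; [congr v|]; lia.
  by apply: mem_joints; lia.
have -> : v i = rot_joint v j i by rewrite /rot_joint ltnNge ij.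
exact: mem_joints.
Qed.

Lemma edge_confined e v j y :
  on_track e v -> j < c -> v j \in e 0 -> y \in e j :\: joints v ->
  y \in confined.
Proof.
move=> T jc vj yN; have [T' W'] := on_track_edge T jc vj.
by apply: (start_confined T'); rewrite W' /rot_edge leq0n subn0.
Qed.

(** The vertex rotation at [y] turns [v j] into a fresh vertex of the first hyperedge. *)
Lemma joint_confined e v j y :
  on_track e v -> j.+1 < c -> y \in e 0 :\: joints v -> y \in e j.+1 ->
  v j \in confined.
Proof.
move=> [P eF] jc yN yj; have fresh := fun i => start_fresh P yN (i := i).
have y0 : y \in e 0 by case/setDP: yN.
have jm := ltcm jc.
have := semipath_rot_vertex P y0 fresh (j := j.+1).
rewrite jm /= => /(_ isT yj) [P' vj0 vjf].
apply: (start_confined (conj P' _)) => [i ic|].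
  by rewrite /rot_edge; case: ifP => _; apply: eF; lia.
rewrite inE vj0 andbT; apply/negP => /imsetP[i _] /eqP; apply/negP; apply: vjf.
exact: ltcm.
Qed.

(** The rotation at the chord [l] puts [e l] in front and leaves [v j] and [e j.+1] in place, as
    [l <= j]. *)
Lemma joint_confined_after e v l j y :
  on_track e v -> l <= j -> j.+1 < c -> v l \in e 0 ->
  y \in e l :\: joints v -> y \in e j.+1 -> v j \in confined.
Proof.
move=> T lj jc vl yN yj; have [T' W'] := on_track_edge T (leq_ltn_trans lj (ltnW jc)) vl.
have -> : v j = rot_joint v l j by rewrite /rot_joint ltnNge lj.
apply: (joint_confined (y := y) T') => //.
  by rewrite W' /rot_edge leq0n subn0.
by rewrite /rot_edge leqNgt ltnS lj.
Qed.

(** The rotation at [l] reverses the order: [e j] moves to position [l - j], and [v j] to the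
    position just before it. *)
Lemma joint_confined_before e v l j y :
  on_track e v -> j < l -> l < c -> v l \in e 0 ->
  y \in e l :\: joints v -> y \in e j -> v j \in confined.
Proof.
move=> T jl lc vl yN yj; have [T' W'] := on_track_edge T lc vl.
have -> : v j = rot_joint v l (l - j.+1).
  by rewrite /rot_joint; case: ltnP => ?; [congr v|]; lia.
apply: (joint_confined (y := y) T'); first lia.
  by rewrite W' /rot_edge leq0n subn0.
have le : (l - j.+1).+1 = l - j by lia.
by rewrite /rot_edge le leq_subr subKn // ltnW.
Qed.

Lemma card_setI_joints e v :
  semipath E m e v -> #|e 0 :&: joints v| = #|chords e v|.
Proof.
move=> [_ _ _ vinj].
have -> : e 0 :&: joints v = [set v (i : 'I_c) | i in chords e v].
  apply/setP => y; apply/setIP/imsetP => [[y0 /imsetP[i _ yi]]|[i]].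
    by exists i; rewrite // inE -yi.
  by rewrite inE => vi0 ->; split=> //; exact: mem_joints.
apply: card_in_imset => i j _ _ /vinj ij; apply/val_inj/ij; rewrite inE; exact: ltcm.
Qed.

Lemma card_edge e v i : semipath E m e v -> i < c -> #|e i| = r.
Proof.
move=> [ev _ _ _] /ltcm /ev [eE _].
by apply/eqP; move/forall_inP: Er; apply.
Qed.

(** There are at most [c <= k - 1 <= r - 2] joints. *)
Lemma card_edge_joints e v i :
  semipath E m e v -> i < c -> 1 < #|e i :\: joints v|.
Proof.
move=> P ic; have := card_edge P ic; rewrite -(cardsID (joints v)).
have : #|e i :&: joints v| <= c.
  rewrite (leq_trans (subset_leq_card (subsetIr _ _))) //.
  by rewrite (leq_trans (leq_imset_card _ _)) ?card_ord.
by rewrite /c; lia.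
Qed.


Section FewConfined.
Hypothesis few : #|confined| < r.

Definition chord_preds e v : {set V} :=
  [set v j.-1 | j : 'I_c in [set j : 'I_c in chords e v | 0 < j]].

(* A chord j whose predecessor v_(j-1) is not confined has its private part
   e_j \ joints disjoint from all earlier ones, and that part contains at least
   two confined vertices; so such chords would make the confined set too large. *)
Lemma confined_eq e v :
  on_track e v -> confined = (e 0 :\: joints v) :|: chord_preds e v.
Proof.
move=> T; have [P _] := T; have [_ _ _ vinj] := P.
have vI i j : i < c -> j < c -> v i = v j -> i = j.
  by move=> /ltcm im /ltcm jm /vinj; apply.
pose G := [set j : 'I_c in chords e v | (0 < j) && (v j.-1 \in confined)].
pose D := [set j : 'I_c in chords e v | (0 < j) && (v j.-1 \notin confined)].
pose N (j : 'I_c) := e j :\: joints v.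
have sDN : \bigcup_(j in D) N j \subset confined.
  apply/bigcupsP => j /setIdP[+ _]; rewrite inE => vj.
  by apply/subsetP => y; exact: edge_confined.
have dis0 j : j \in D -> [disjoint e 0 :\: joints v & N j].
  move=> /setIdP[+ /andP[j0 nc]]; rewrite inE => vj.
  rewrite disjoint_subset; apply/subsetP => y yN.
  rewrite inE; apply: contra nc => /setDP[yj _].
  by apply: (joint_confined T _ yN); rewrite prednK.
have disD (i j : 'I_c) : i \in D -> j \in D -> i < j -> [disjoint N i & N j].
  move=> /setIdP[+ _] /setIdP[+ /andP[j0 nc]] ij; rewrite !inE => vi vj.
  rewrite disjoint_subset; apply/subsetP => y yN.
  rewrite inE; apply: contra nc => /setDP[yj _].
  by apply: (joint_confined_after T _ _ vi yN); rewrite ?prednK //; lia.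
have cD : 2 * #|D| <= #|\bigcup_(j in D) N j|.
  apply: leq_mul_card_bigcup => [j _|i j iD jD]; first exact: card_edge_joints P _.
  rewrite neq_ltn => /orP[ij|ji]; first exact: disD.
  by rewrite disjoint_sym; exact: disD.
pose X := e 0 :\: joints v; pose Y := \bigcup_(j in D) N j.
pose Z := [set v j.-1 | j : 'I_c in G].
have sZ : Z \subset confined.
  by apply/subsetP => _ /imsetP[j /setIdP[_ /andP[]] + + ->].
have sX : X \subset confined by apply/subsetP => y; exact: start_confined.
have cZ : #|Z| = #|G|.
  apply: card_in_imset => i j /setIdP[_ /andP[i0 _]] /setIdP[_ /andP[j0 _]].
  move=> /vI ij; apply: val_inj => /=; have := ltn_ord i; have := ltn_ord j; lia.
have cX : #|X| + #|chords e v| = r.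
  by rewrite -(card_setI_joints P) -(card_edge P c_gt0) addnC cardsID.
have cJ : #|chords e v| <= (#|G| + #|D|).+1.
  have sJ : chords e v \subset Ordinal c_gt0 |: (G :|: D).
    apply/subsetP => j vj; rewrite in_setU1 in_setU -val_eqE /=.
    case: posnP => //= j0; have [cj|cj] := boolP (v j.-1 \in confined).
      by rewrite (_ : j \in G) //; apply/setIdP; rewrite vj j0 cj.
    by rewrite orbC (_ : j \in D) //; apply/setIdP; rewrite vj j0 cj.
  apply: leq_trans (subset_leq_card sJ) _; rewrite cardsU1 -add1n.
  by apply: leq_add; [exact: leq_b1 | exact: (leq_card_setU G D).1].
have dXY : [disjoint X & Y] by apply/bigcup_disjointP.
have dXYZ : [disjoint X :|: Y & Z].
  rewrite disjoint_sym disjoint_subset; apply/subsetP => _ /imsetP[j _ ->].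
  have vW : v j.-1 \in joints v by apply: mem_joints; have := ltn_ord j; lia.
  by rewrite !inE vW /=; apply/bigcupP => -[i _]; rewrite inE vW.
have cXYZ : #|X :|: Y :|: Z| = #|X| + #|Y| + #|G|.
  by rewrite cardsU disjoint_setI0 // cards0 subn0 cZ cardsU disjoint_setI0 // cards0 subn0.
have sXYZ : X :|: Y :|: Z \subset confined by rewrite !subUset sX sDN sZ.
(* Only chord 0 has no predecessor, so |X| + |G| + |D| >= r - 1; but |X| + |Y| + |G| <= r - 1 and
   |Y| >= 2|D|. Hence [D] is empty, and then X and Z fill [confined]. *)
have /eqP : #|D| = 0.
  by have := subset_leq_card sXYZ; rewrite cXYZ; rewrite -/Y in cD; lia.
rewrite cards_eq0 => /eqP D0.
have Y0 : Y = set0 by rewrite /Y D0 big_set0.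
rewrite Y0 setU0 ?cards0 ?addn0 in sXYZ cXYZ.
rewrite D0 cards0 addn0 in cJ.
have -> : chord_preds e v = Z.
  rewrite /chord_preds; congr [set _ | _ in pred_of_set _]; apply/setP => j.
  apply/setIdP/setIdP => -[vj]; last by case/andP.
  move=> j0; split=> //; rewrite j0 /=; apply: contraT => nc.
  by have := in_set0 j; rewrite -D0 => <-; apply/setIdP; rewrite vj j0 nc.
apply/esym/eqP; rewrite eqEcard sXYZ cXYZ.
lia.
Qed.

(** By [confined_eq], a confined joint must be the predecessor of a chord, and distinct positions
    carry distinct joints. *)
Lemma chord_pred_of_confined e v i :
  on_track e v -> i < c -> v i \in confined -> i.+1 < c /\ v i.+1 \in e 0.
Proof.
move=> T ic; have [[_ _ _ vinj] _] := T.
rewrite (confined_eq T) in_setU in_setD mem_joints //=.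
case/imsetP => j /setIdP[+ j0] /vinj; rewrite !inE => vj /(_ (ltcm ic)).
have jc := ltn_ord j; rewrite (leq_trans _ c_le_m) => [/(_ isT) ->|]; last by lia.
by rewrite prednK.
Qed.

Section MaximalChords.
Variables (e : nat -> {set V}) (v : nat -> V).
Hypothesis T : on_track e v.
Hypothesis chords_max :
  forall e' v', on_track e' v' -> #|chords e' v'| <= #|chords e v|.

(** The left side is confined and contains no joint, so [confined_eq] places it inside the right
    side. Rotating at [j] makes [e j] first, and maximality of the chords says that [e j] has no
    more joints than [e 0], hence at least as large a private part. *)
Lemma private_part_chord j :
  j < c -> v j \in e 0 -> e j :\: joints v = e 0 :\: joints v.
Proof.
move=> jc vj; have [P _] := T; apply/eqP; rewrite eqEcard; apply/andP; split.
  apply/subsetP => y yN; have := edge_confined T jc vj yN.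
  rewrite (confined_eq T) => /setUP[//|/imsetP[i _ yi]].
  case/setDP: yN => _; rewrite yi mem_joints //; have := ltn_ord i; lia.
have [T' W'] := on_track_edge T jc vj; have [P' _] := T'.
have := chords_max T'; rewrite -(card_setI_joints P) -(card_setI_joints P') W'.
rewrite /rot_edge leq0n subn0 => le.
have := cardsID (joints v) (e 0); have := cardsID (joints v) (e j).
by rewrite (card_edge P jc) (card_edge P c_gt0); lia.
Qed.

(** If [i < j] are both chords, [e i] and [e j] have a common private vertex, which makes [v i]
    confined; then [i.+1] is a chord too. *)
Lemma chords_closed i j :
  i <= j -> j < c -> v j \in e 0 -> v i \in e 0.
Proof.
move=> + jc vj; elim: i => [_|i IHi ij].
  by have [[+ _ _ _] _] := T => /(_ 0 m_gt0)[].
have ic := ltn_trans ij jc.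
have [P _] := T; have := card_edge_joints P jc; case/card_gt1P => y [_ [yN _ _]].
have : y \in e i :\: joints v.
  by rewrite (private_part_chord ic (IHi (ltnW ij))) -(private_part_chord jc vj).
case/setDP => yi _.
by have [] := chord_pred_of_confined T ic (joint_confined_before T ij jc vj yN yi).
Qed.

End MaximalChords.

(* If |e_0 :&: joints| is maximal, all chords j have the same private part
   e_j \ joints, and the chords form an initial segment.  If that segment
   contained 1, the rotation starting with e_1 would have the same chords, so
   that e_1 = e_0. *)
Lemma few_confined_pendant e v :
  on_track e v ->
  (forall e' v', on_track e' v' -> #|chords e' v'| <= #|chords e v|) ->
  exists S : {set V}, [/\ S \subset e 0, #|S| = r.-1 & incident E S \subset [set e 0]].
Proof.
move=> T Tmax; have [P _] := T; have [ev _ einj vinj] := P.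
have [|no1] := boolP ((1 < c) && (v 1 \in e 0)).
  case/andP=> c1 v1; have [T' W'] := on_track_edge T c1 v1.
  have [P' _] := T'; set e' := rot_edge e 1 in T' P'; set v' := rot_joint v 1 in T' W' P'.
  have e'0 : e' 0 = e 1 by [].
  have v'E i : v' i = v i by rewrite /v' /rot_joint; case: i.
  have N1 := private_part_chord T Tmax c1 v1.
  have eqJ : #|chords e' v'| = #|chords e v|.
    rewrite -(card_setI_joints P) -(card_setI_joints P') W' e'0.
    have := cardsID (joints v) (e 0); have := cardsID (joints v) (e 1).
    by rewrite N1 (card_edge P c1) (card_edge P c_gt0); lia.
  have Tmax' e2 v2 : on_track e2 v2 -> #|chords e2 v2| <= #|chords e' v'|.
    by rewrite eqJ; exact: Tmax.
  (* Both chord sets are initial segments, hence comparable, and they have the same size. *)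
  have chordsE : chords e' v' = chords e v.
    have [sub|/subsetPn[j]] := boolP (chords e' v' \subset chords e v).
      by apply/eqP; rewrite eqEcard sub eqJ /=.
    rewrite !inE => v'j vj; apply/esym/eqP; rewrite eqEcard eqJ leqnn andbT.
    apply/subsetP => i; rewrite !inE => vi; have [ij|ji] := leqP i j.
      exact: (chords_closed T' Tmax' ij).
    by rewrite (chords_closed T Tmax (ltnW ji)) in vj.
  suff /einj : e 1 = e 0 by rewrite !inE (ltcm c1) m_gt0 => /(_ isT isT).
  apply/setP => y; have [/imsetP[i _ ->]|yW] := boolP (y \in joints v).
    by have /setP/(_ i) := chordsE; rewrite !inE e'0 v'E.
  by have /setP/(_ y) := N1; rewrite !inE yW.
have noj j : 0 < j < c -> v j \notin e 0.
  case/andP=> j0 jc; apply: contra no1 => vj.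
  by rewrite (leq_ltn_trans j0 jc) (chords_closed T Tmax j0 jc).
exists (e 0 :\: joints v); split; first exact: subsetDl.
  have : chords e v \subset [set Ordinal c_gt0].
    apply/subsetP => j; rewrite !inE -val_eqE /= => vj.
    by case: posnP => // j0; have := noj j; rewrite j0 ltn_ord vj => /(_ isT).
  move/subset_leq_card; rewrite cards1 -(card_setI_joints P).
  have := cardsID (joints v) (e 0); rewrite (card_edge P c_gt0).
  have : v 0 \in e 0 :&: joints v.
    by rewrite inE mem_joints ?c_gt0 //; have [_ ->] := ev 0 m_gt0.
  by rewrite (cardsD1 (v 0)) => ->; lia.
(* A second hyperedge [e i.+1] at a private vertex of [e 0] would make [v i] confined and so [i.+1]
   a chord, but 0 is the only one. *)
apply/subsetP => h /setIdP[hE]; rewrite -setI_eq0 => /set0Pn[y /setIP[yh yN]].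
have [[|i] ic hi] := start_incident P yN hE yh; first by rewrite inE hi.
rewrite hi in yh; have vi := joint_confined T ic yN yh.
have [_ vi1] := chord_pred_of_confined T (ltnW ic) vi.
by have := noj i.+1; rewrite ic vi1 => /(_ isT).
Qed.

End FewConfined.
End LongestSemipath.

Lemma semipath_length E m e v : semipath E m e v -> m <= #|E|.
Proof.
move=> [ev _ einj _]; rewrite -[m]card_ord -(card_in_imset (f := fun i : 'I_m => e i)).
  by apply/subset_leq_card/subsetP => _ /imsetP[i _ ->]; have [] := ev i (ltn_ord i).
by move=> i j _ _ /einj ij; apply: val_inj; apply: ij; exact: ltn_ord.
Qed.

(** If at least [r] vertices are confined, any [r] of them do. Otherwise, with [F] unchanged, the
    semipath on track with the most chords is taken and its first hyperedge is pendant. *)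
Lemma sparse_set E k r :
  is_rgraph r E -> BC_free k E -> 1 < k -> k < r -> E != set0 ->
  exists2 S : {set V}, S \subset cover E &
    #|S| = r /\ #|incident E S| <= k.-1 \/ #|S| = r.-1 /\ #|incident E S| <= 1.
Proof.
move=> Er Ef k1 kr /set0Pn[h hE].
have hr : #|h| = r by apply/eqP; move/forall_inP: Er; apply.
have [y yh] : exists y, y \in h by apply/set0Pn; rewrite -card_gt0; lia.
have [||m [e [v P]] mmax] := @exists_max (fun m => exists e v, semipath E m e v) #|E| 1.
- by exists (fun=> h), (fun=> y); split=> // -[|i] [|j].
- by move=> j [e [v /semipath_length]].
have m0 : 0 < m.
  by apply: mmax; exists (fun=> h), (fun=> y); split=> // -[|i] [|j].
have {}mmax e' v' : ~ semipath E m.+1 e' v'.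
  by move=> P'; have := mmax m.+1 (ex_intro _ e' (ex_intro _ v' P')); rewrite ltnn.
pose F := [set e i | i : 'I_(minn m k.-1)].
have FE : #|F| <= k.-1.
  by rewrite (leq_trans (leq_imset_card _ _)) // card_ord geq_minr.
have T : on_track E F k m e v.
  by split=> // i ic; apply/imsetP; exists (Ordinal ic).
have [big|few] := leqP r #|confined E F|.
  have [S SC Sr] := exists_subset_card big; exists S.
    by apply: subset_trans SC _; apply/subsetP => x /setIdP[].
  left; split=> //; apply: leq_trans FE; apply/subset_leq_card/subsetP => g.
  case/setIdP=> gE; rewrite -setI_eq0 => /set0Pn[x /setIP[xg /(subsetP SC)/setIdP[_]]].
  by move/forall_inP/(_ g gE)/implyP/(_ xg).
have [||a [e1 [v1 [T1 a1]]] amax] := @exists_max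
  (fun a => exists e v, on_track E F k m e v /\ #|chords k m e v| = a)
  (minn m k.-1) #|chords k m e v|.
- by exists e, v.
- by move=> _ [e' [v' [_ <-]]]; rewrite -[leqRHS]card_ord max_card.
have [|S [Se Sr inc]] := few_confined_pendant Er Ef k1 kr m0 mmax few T1.
  by move=> e' v' T'; rewrite a1; apply: amax; exists e', v'.
exists S; last by right; rewrite -(cards1 (e1 0)) subset_leq_card.
apply: subset_trans Se _; have [[+ _ _ _] _] := T1 => /(_ 0 m0)[eE _].
by apply: bigcup_max eE _.
Qed.
End SparseSet.

(** * Arithmetic of the bound *)

Definition berge_bound (k r n : nat) := (n - 1) %/ r * (k - 1) + ind_pos_multiple r n.

Lemma berge_boundE k r q s :
  s < r -> berge_bound k r (q * r + s.+1) = q * (k - 1) + (s.+1 == r).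
Proof.
move=> sr; rewrite /berge_bound /ind_pos_multiple addnS subn1 /= divnMDl; last by lia.
rewrite divn_small // addn0 -addnS dvdn_addr ?dvdn_mull //.
congr (_ + nat_of_bool _); apply/idP/eqP => [/dvdn_leq|->]; [lia | exact: dvdnn].
Qed.

Lemma pos_decomp r n : 0 < r -> 0 < n -> exists q s, s < r /\ n = q * r + s.+1.
Proof.
move=> r0 n0; exists (n.-1 %/ r), (n.-1 %% r); split; first by rewrite ltn_mod.
by have := divn_eq n.-1 r; lia.
Qed.

Lemma berge_bound_sub k r n :
  0 < r -> r < n -> berge_bound k r n = berge_bound k r (n - r) + (k - 1).
Proof.
move=> r0 rn; have [|[|q] [s [sr nE]]] := @pos_decomp r n r0; try lia.
have -> : n - r = q * r + s.+1 by rewrite nE mulSn; lia.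
by rewrite nE !berge_boundE // mulSn; lia.
Qed.

(** The summand [(r %| n - 1)] records that deleting [r.-1] vertices and one hyperedge is strictly
    wasteful when r | n - 1; this excludes that alternative for extremal hypergraphs. *)
Lemma berge_bound_pred k r n :
  2 < k -> k < r -> r < n ->
  berge_bound k r (n - r.-1) + 1 + (r %| n - 1) <= berge_bound k r n.
Proof.
move=> k2 kr rn; have [| |[|q] [s [sr nE]]] := @pos_decomp r n; try lia.
have -> : (r %| n - 1) = (s == 0).
  rewrite nE addnS subn1 /= dvdn_addr ?dvdn_mull //.
  by case: s sr {nE} => [|s] sr; rewrite ?dvdn0 //; apply/negP => /dvdn_leq; lia.
rewrite [in leqRHS]nE berge_boundE //.
have [sr'|sr'] := eqVneq s.+1 r.
  have -> : n - r.-1 = q.+1 * r + 0.+1 by rewrite nE mulSn; lia.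
  rewrite (@berge_boundE k r q.+1 0); last by lia.
  have -> : (1 == r) = false by apply/negbTE/eqP; lia.
  have -> : (s == 0) = false by apply/negbTE/eqP; lia.
  by rewrite addn0 addn0 leqnn.
have -> : n - r.-1 = q * r + s.+1.+1 by rewrite nE mulSn; lia.
rewrite berge_boundE; last by lia.
rewrite mulSn addn0; set K := q * _; have [s0|s0] := eqVneq s 0; last first.
  by have := leq_b1 (s.+2 == r); rewrite addn0; lia.
have -> : (s.+2 == r) = false by apply/negbTE/eqP; lia.
by rewrite addn0 /=; lia.
Qed.

Lemma card_setD1_geq (T : finType) (A : {set T}) x n : n < #|A| -> n <= #|A :\ x|.
Proof. by rewrite (cardsD1 x A); case: (_ \in _) => // /ltnW. Qed.

Lemma leq_cardsU1 (T : finType) (A : {set T}) x : #|x |: A| <= #|A|.+1.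
Proof. by rewrite cardsU1 -add1n leq_add2r leq_b1. Qed.

(** * The upper bound, long Berge paths, and the structure of extremal hypergraphs *)

Section BergeTrees.
Variable V : finType.
Implicit Types (E F : {set {set V}}) (A B S U h g : {set V}).
Implicit Types (e : nat -> {set V}) (u w x y : V).

Lemma card_rgraph r E h : is_rgraph r E -> h \in E -> #|h| = r.
Proof. by move=> /forall_inP Er /Er/eqP. Qed.

Lemma is_rgraph_sub r E F : F \subset E -> is_rgraph r E -> is_rgraph r F.
Proof.
move=> /subsetP FE Er; apply/forall_inP => h /FE hE; exact/eqP/(card_rgraph Er).
Qed.

Lemma cover_remove E S : cover (E :\: incident E S) \subset cover E :\: S.
Proof.
apply/subsetP => y /bigcupP[h /setDP[hE]]; rewrite inE hE /= negbK => hS yh.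
rewrite inE (disjointFr hS yh) /=; by apply/bigcupP; exists h.
Qed.

Lemma card_remove E S : #|E| = #|E :\: incident E S| + #|incident E S|.
Proof.
rewrite -(cardsID (incident E S) E) addnC; congr (_ + _).
by apply: eq_card => h; rewrite !inE andbA andbb.
Qed.

Lemma rgraph_on_r r E A :
  is_rgraph r E -> cover E \subset A -> #|A| = r -> #|E| <= 1.
Proof.
move=> Er EA Ar; rewrite -(cards1 A); apply/subset_leq_card/subsetP => h hE.
rewrite inE eqEcard Ar (card_rgraph Er hE) leqnn andbT.
by apply: subset_trans EA; exact: bigcup_max hE _.
Qed.

Lemma leq_card_of_mem r E A h :
  is_rgraph r E -> cover E \subset A -> h \in E -> r <= #|A|.
Proof.
move=> Er EA hE; rewrite -(card_rgraph Er hE); apply: subset_leq_card.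
by apply: subset_trans EA; exact: bigcup_max hE _.
Qed.

(** The vertex set [A] is a parameter so that vertices can be deleted within the same type. The
    indicator term comes from |A| = r, where one hyperedge fits. *)
Lemma BC_free_upper_bound k r E A :
  2 < k -> k < r -> is_rgraph r E -> BC_free k E -> cover E \subset A ->
  #|E| <= berge_bound k r #|A|.
Proof.
move=> k2 kr; move: {2}#|A| (leqnn #|A|) => n.
elim: n E A => [|n IHn] E A An Er Ef EA.
  have [->|[h hE]] := set_0Vmem E; first by rewrite cards0.
  by have := leq_card_of_mem Er EA hE; lia.
have [->|[h hE]] := set_0Vmem E; first by rewrite cards0.
have rA := leq_card_of_mem Er EA hE.
have [Ar|Ar] := eqVneq #|A| r.
  apply: leq_trans (rgraph_on_r Er EA Ar) _.
  by have := @berge_boundE k r 0 r.-1; rewrite add0n prednK ?Ar ?eqxx; lia.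
have {Ar} rA : r < #|A| by rewrite ltn_neqAle eq_sym Ar.
have E0 : E != set0 by apply/set0Pn; exists h.
have [S SE S_small] := sparse_set Er Ef (ltnW k2) kr E0.
have SA := subset_trans SE EA.
have IH : #|S| > 0 -> #|E :\: incident E S| <= berge_bound k r (#|A| - #|S|).
  move=> S0; rewrite -(cardsDS SA); apply: IHn.
  - by rewrite cardsDS //; lia.
  - by apply: is_rgraph_sub Er; exact: subsetDl.
  - by apply: BC_free_sub Ef; exact: subsetDl.
  by apply: subset_trans (cover_remove E S) _; exact: setSD.
rewrite (card_remove E S); case: S_small => -[Sr inc]; rewrite Sr in IH.
  by rewrite (@berge_bound_sub _ _ #|A|); have := IH; lia.
by have := @berge_bound_pred k r #|A| k2 kr rA; have := IH; lia.
Qed.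

(** A Berge path with [m] hyperedges; [U] constrains its chosen vertices only, not the whole
    hyperedges. *)
Definition linked E U m (u w : V) : Prop :=
  exists e, exists x : nat -> V, [/\ forall i, i < m -> [/\ e i \in E, x i \in e i & x i.+1 \in e i],
    forall i, i <= m -> x i \in U, {in gtn m &, injective e},
    {in geq m &, injective x} & x 0 = u /\ x m = w].

Lemma linked_sub E F U U' m u w :
  E \subset F -> U \subset U' -> linked E U m u w -> linked F U' m u w.
Proof.
move=> /subsetP EF /subsetP UU [e [x [ex xU ei xi ends]]]; exists e, x; split=> //.
  by move=> i /ex[/EF].
by move=> i /xU/UU.
Qed.

Lemma linked_sym E U m u w : linked E U m u w -> linked E U m w u.
Proof.
move=> [e [x [ex xU ei xi [x0 xm]]]].
exists (fun i => e (m - i.+1)), (fun i => x (m - i)); split.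
- move=> i im; have [-> x1 x2] := ex (m - i.+1) ltac:(lia); split=> //.
  by rewrite (_ : m - i = (m - i.+1).+1) //; lia.
- by move=> i im; apply: xU; lia.
- by move=> i j; rewrite !inE => im jm /ei; rewrite !inE; lia.
- by move=> i j; rewrite !inE => im jm /xi; rewrite !inE; lia.
by rewrite subn0 subnn.
Qed.

Lemma linked_cons E U m u w h y :
  linked E U m u w -> h \notin E -> u \in h -> y \in h -> y \notin U ->
  linked (h |: E) (y |: U) m.+1 y w.
Proof.
move=> [e [x [ex xU ei xi [x0 xm]]]] hE uh yh yU.
exists (fun i => if i is i'.+1 then e i' else h).
exists (fun i => if i is i'.+1 then x i' else y); split=> //.
- move=> [|i] im; first by rewrite x0 setU11.
  by have [eE x1 x2] := ex i im; split=> //; rewrite setU1r.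
- by move=> [|i] im; rewrite ?setU11 // setU1r // xU.
- move=> [|i] [|j]; rewrite !inE //.
  + by move=> _ jm he; have [] := ex j jm; rewrite -he (negPf hE).
  + by move=> im _ he; have [] := ex i im; rewrite he (negPf hE).
  by move=> im jm /ei ->.
- move=> [|i] [|j]; rewrite !inE //.
  + by move=> _ jm yx; have := xU j jm; rewrite -yx (negPf yU).
  + by move=> im _ yx; have := xU i im; rewrite yx (negPf yU).
  by move=> im jm /xi ->.
Qed.

Lemma linked1 (h : {set V}) U u w :
  u != w -> u \in h -> w \in h -> u \in U -> w \in U -> linked [set h] U 1 u w.
Proof.
move=> uw uh wh uU wU; exists (fun=> h), (fun i => if i is 0 then u else w).
split=> //.
- by move=> [|i] // _; split; rewrite ?set11.
- by move=> [|i].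
- by move=> [|i] [|j].
by move=> [|[|i]] [|[|j]] //; rewrite ?inE // => _ _ uw'; rewrite uw' eqxx in uw.
Qed.

Lemma linked_close k E F U m u w h :
  BC_free k F -> E \subset F -> linked E U m u w -> k <= m.+1 ->
  h \in F -> h \notin E -> u \in h -> w \in h -> False.
Proof.
move=> Ff /subsetP EF [e [x [ex xU ei xi [x0 xm]]]] km hF hE uh wh.
apply: (@BC_free_no_cycle _ k F m.+1 x (fun i => if i < m then e i else h)) => //.
- move=> i; rewrite ltnS leq_eqVlt => /predU1P[->|im].
    by rewrite ltnn modnn xm x0.
  by rewrite im modn_small //; have [/EF] := ex i im.
move=> i j; rewrite !inE !ltnS => im jm.
case: ltnP => im'; case: ltnP => jm'; last by lia.
- exact: ei.
- by move=> he; have [] := ex i im'; rewrite he (negPf hE).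
by move=> he; have [] := ex j jm'; rewrite -he (negPf hE).
Qed.

Section Block.
Variables (r : nat) (B : {set V}).
Hypothesis cB : #|B| = r.+1.

Lemma block_edge_missing h u :
  h \subset B -> #|h| = r -> u \in B -> u \notin h -> h = B :\ u.
Proof.
move=> hB hr uB uh; apply/eqP; rewrite eqEcard; apply/andP; split.
  by apply/subsetD1P.
by have := cardsD1 u B; rewrite uB; lia.
Qed.

Lemma block_edge_card_setI h g :
  h \subset B -> g \subset B -> #|h| = r -> #|g| = r -> r.-1 <= #|h :&: g|.
Proof.
move=> hB gB hr gr; have := cardsUI h g.
have : #|h :|: g| <= #|B| by apply: subset_leq_card; rewrite subUset hB.
lia.
Qed.

(** The path takes the hyperedges in the given order; [Z] collects the vertices already used.
    Consecutive hyperedges share at least [r.-1] vertices, and the next joint has to avoid [u], [w]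
    and [Z], which the inequality on [r] permits at each step. *)
Lemma block_linked_seq (f : {set V}) (s : seq {set V}) (Z : {set V}) u w :
  {in f :: s, forall h, h \subset B /\ #|h| = r} -> uniq (f :: s) ->
  u != w -> u \in f -> w \in last f s -> u \notin Z -> w \notin Z ->
  #|Z| + size s + 3 <= r -> linked [set h in f :: s] (B :\: Z) (size s).+1 u w.
Proof.
elim: s f Z u => [|g s IHs] f Z u fs us uw uf ws uZ wZ Zr.
  have [fB _] := fs f (mem_head _ _); have uB := subsetP fB _ uf.
  have wB := subsetP fB _ ws.
  apply: (@linked_sub [set f] _ (B :\: Z)) => //.
    by apply/subsetP => h; rewrite !inE.
  by apply: linked1; rewrite // inE ?uZ ?wZ.
have [fB fr] := fs f (mem_head _ _); have [gB gr] : g \subset B /\ #|g| = r by apply: fs; rewrite !inE eqxx orbT.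
have fg := block_edge_card_setI fB gB fr gr.
have [y] : exists y, y \in (f :&: g) :\: (u |: (w |: Z)).
  apply/set0Pn; rewrite -card_gt0 cardsD subn_gt0; apply: leq_trans fg.
  have c2 := leq_trans (leq_cardsU1 (w |: Z) u) (leq_cardsU1 Z w : _ < #|Z|.+2).
  apply: leq_ltn_trans (subset_leq_card (subsetIr _ _)) _.
  by apply: leq_ltn_trans c2 _; move: Zr => /=; lia.
rewrite !inE !negb_or => /andP[/and3P[yu yw yZ] /andP[yf yg]].
have L : linked [set h in g :: s] (B :\: (u |: Z)) (size s).+1 y w.
  apply: IHs => //.
  - by move=> h hs; apply: fs; rewrite inE hs orbT.
  - by case/andP: us.
  - by rewrite in_setU1 negb_or yu.
  - by rewrite in_setU1 negb_or eq_sym uw.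
  by apply: leq_trans Zr; rewrite cardsU1 uZ add1n addSnnS.
apply: linked_sub (linked_cons L _ yf uf _).
- by apply/subsetP => h; rewrite !inE.
- apply/subsetP => z; rewrite !inE => /predU1P[->|].
    by rewrite uZ (subsetP fB).
  by rewrite negb_or => /andP[/andP[_ ->]].
- by rewrite inE; case/andP: us.
by rewrite !inE eqxx.
Qed.

Variables (k : nat) (F : {set {set V}}).
Hypotheses (k_ge4 : 4 <= k) (k_lt_r : k < r).
Hypotheses (FB : forall h, h \in F -> h \subset B /\ #|h| = r) (cF : #|F| = k - 1).

Lemma block_edge_avoid g g' : exists2 h, h \in F & h != g /\ h != g'.
Proof.
have /set0Pn[h] : F :\ g :\ g' != set0.
  by rewrite -card_gt0; do 2!apply: card_setD1_geq; rewrite cF; lia.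
by move=> /setD1P[hg' /setD1P[hg hF]]; exists h.
Qed.

(** The only candidates missing [u] or [w] are [B :\ u] and [B :\ w], and [F] has at least three
    members. *)
Lemma block_edge_through u w :
  u \in B -> w \in B -> exists2 h, h \in F & u \in h /\ w \in h.
Proof.
move=> uB wB; have [h hF [hu hw]] := block_edge_avoid (B :\ u) (B :\ w).
have [hB hr] := FB hF; exists h => //; split.
  by apply: contraR hu => uh; apply/eqP; exact: block_edge_missing.
by apply: contraR hw => wh; apply/eqP; exact: block_edge_missing.
Qed.

(** All of [F] is traversed, from some [f] containing [u] to another [g] containing [w]; the room
    needed is (k - 2) + 3 <= r. *)
Lemma block_linked u w :
  u \in B -> w \in B -> u != w -> linked F B (k - 1) u w.
Proof.
move=> uB wB uw; have [f fF [fu _]] := block_edge_avoid (B :\ u) (B :\ u).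
have [g gF [gw gf]] := block_edge_avoid (B :\ w) f.
have [fB fr] := FB fF; have [gB gr] := FB gF.
have uf : u \in f by apply: contraR fu => uf; apply/eqP; exact: block_edge_missing.
have wg : w \in g by apply: contraR gw => wg; apply/eqP; exact: block_edge_missing.
pose s := rcons (enum (F :\ f :\ g)) g.
have fsF h : (h \in f :: s) = (h \in F).
  rewrite inE mem_rcons inE mem_enum !inE.
  by case: eqP => [->|] //=; case: eqP => [->|].
have us : uniq (f :: s).
  rewrite /= rcons_uniq enum_uniq mem_rcons inE !mem_enum !inE !eqxx eq_sym.
  by rewrite (negPf gf).
have ss : (size s).+1 = k - 1.
  rewrite -cF -[_.+1]/(size (f :: s)) -(card_uniqP us); apply: eq_card => h; exact: fsF.
have := @block_linked_seq f s set0 u w; rewrite ss setD0 cards0.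
move=> L; apply: linked_sub (L _ us uw uf _ _ _ _) => //.
- by apply/subsetP => h; rewrite inE fsF.
- by move=> h; rewrite fsF; exact: FB.
- by rewrite last_rcons.
- by rewrite inE.
- by rewrite inE.
by move: (size s) ss k_ge4 k_lt_r => n; clear; lia.
Qed.

End Block.

(** Block trees grown leaf by leaf, the form suited to induction. The shadow of each glued block is
    complete by [block_edge_through], hence 2-connected. *)
Inductive berge_tree (k r : nat) : {set V} -> {set {set V}} -> Prop :=
| BergeTreePoint (x : V) : berge_tree k r [set x] set0
| BergeTreeGlue A E (x : V) S F of berge_tree k r A E & x \in A & [disjoint A & S] &
    #|S| = r & #|F| = k - 1 & (forall h, h \in F -> h \subset x |: S /\ #|h| = r) :
    berge_tree k r (A :|: S) (E :|: F).

Section BergeTree.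
Variables (k r : nat).
Hypotheses (k_ge4 : 4 <= k) (k_lt_r : k < r).

Lemma berge_tree_edge A E h :
  berge_tree k r A E -> h \in E -> h \subset A /\ #|h| = r.
Proof.
move=> T; elim: {A E} T h => [x|A E x S F _ IH xA _ _ _ FS] h; first by rewrite inE.
case/setUP => [/IH[hA hr]|/FS[hS hr]]; split=> //.
  exact: subset_trans hA (subsetUl _ _).
by apply: subset_trans hS _; rewrite subUset sub1set inE xA subsetUr.
Qed.

Lemma glue_edge_notin A (x : V) S F h :
  [disjoint A & S] -> (forall h, h \in F -> h \subset x |: S /\ #|h| = r) ->
  h \in F -> ~~ (h \subset A).
Proof.
move=> AS FS /FS[hS hr]; apply/negP => hA.
have : h \subset [set x].
  apply/subsetP => y yh; have /setU1P[->|yS] := subsetP hS _ yh; first by rewrite inE.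
  by rewrite (disjointFr AS (subsetP hA _ yh)) in yS.
by move/subset_leq_card; rewrite cards1 hr; lia.
Qed.

Lemma berge_tree_card A E :
  berge_tree k r A E -> exists q, #|A| = q * r + 1 /\ #|E| = q * (k - 1).
Proof.
elim=> {A E} [x|A E x S F T [q [Aq Eq]] xA AS Sr Fk FS].
  by exists 0; rewrite cards1 cards0.
exists q.+1; rewrite !mulSn !cardsU disjoint_setI0 // cards0 Aq Sr.
rewrite disjoint_setI0 ?cards0 ?Eq ?Fk; first by lia.
rewrite disjoint_subset; apply/subsetP => h /(berge_tree_edge T)[hA _].
by apply/negP => /(glue_edge_notin AS FS); rewrite hA.
Qed.

Lemma card_glue_block A (x : V) S : x \in A -> [disjoint A & S] -> #|S| = r -> #|x |: S| = r.+1.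
Proof. by move=> xA AS Sr; rewrite cardsU1 (disjointFr AS xA) Sr. Qed.

(** Between an old vertex other than [x] and a new one, a long path to [x] inside [A] is prolonged
    by one hyperedge of the new block; in the other cases the old part or the new block alone
    provides the path. *)
Lemma berge_tree_linked A E u w :
  berge_tree k r A E -> u \in A -> w \in A -> u != w ->
  exists2 m, k - 1 <= m & linked E A m u w.
Proof.
move=> T; elim: {A E} T u w => [x|A E x S F T IH xA AS Sr Fk FS] u w.
  by rewrite !inE => /eqP-> /eqP->; rewrite eqxx.
have cB := card_glue_block xA AS Sr.
have mixed a b : a \in A -> b \in S -> exists2 m, k - 1 <= m & linked (E :|: F) (A :|: S) m a b.
  move=> aA bS; have [->|ax] := eqVneq a x.
    exists (k - 1) => //; apply: linked_sub (block_linked cB k_ge4 k_lt_r FS Fk _ _ _).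
    - exact: subsetUr.
    - by rewrite subUset sub1set inE xA subsetUr.
    - exact: setU11.
    - exact: setU1r.
    by apply: contraTneq xA => ->; rewrite (disjointFl AS bS).
  have [m km L] := IH a x aA xA ax.
  have [|h hF [xh bh]] := block_edge_through cB k_ge4 k_lt_r FS Fk (setU11 x S) (w := b).
    exact: setU1r.
  exists m.+1; first exact: leqW.
  apply: linked_sym; apply: linked_sub (linked_cons (linked_sym L) _ xh bh _).
  - rewrite subUset sub1set inE hF orbT; exact: subsetUl.
  - rewrite subUset sub1set inE bS orbT; exact: subsetUl.
  - apply: contra (glue_edge_notin AS FS hF) => /(berge_tree_edge T)[//].
  by rewrite (disjointFl AS bS).
case/setUP=> [uA|uS] /setUP[wA|wS] uw.
- have [m km L] := IH u w uA wA uw; exists m => //.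
  by apply: linked_sub L; exact: subsetUl.
- exact: mixed.
- by have [m km L] := mixed w u wA uS; exists m => //; exact: linked_sym.
exists (k - 1) => //; apply: linked_sub (block_linked cB k_ge4 k_lt_r FS Fk _ _ uw).
- exact: subsetUr.
- by rewrite subUset sub1set inE xA subsetUr.
- exact: setU1r.
exact: setU1r.
Qed.

Section Attach.
Variables (E E' : {set {set V}}) (A : {set V}).
Hypotheses (Ef : BC_free k E) (T : berge_tree k r A E') (E'E : E' \subset E).

(** Two common vertices would be joined by a path of at least [k - 1] hyperedges inside the tree,
    which [h] closes to a long cycle. *)
Lemma attached_edge_point h u w :
  h \in E -> ~~ (h \subset A) -> u \in A -> u \in h -> w \in A -> w \in h -> u = w.
Proof.
move=> hE hA uA uh wA wh; apply/eqP; apply: contraT => uw.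
have [m km L] := berge_tree_linked T uA wA uw.
case: (linked_close Ef E'E L _ hE _ uh wh); first by clear -km; lia.
by apply: contra hA => /(berge_tree_edge T)[].
Qed.

(** Otherwise a long path inside the tree is closed by the detour [h], [s], [g]. *)
Lemma attached_edges_point h g u w s :
  h \in E -> ~~ (h \subset A) -> g \in E -> ~~ (g \subset A) -> h != g ->
  u \in A -> u \in h -> w \in A -> w \in g ->
  s \in h -> s \in g -> s \notin A -> u = w.
Proof.
move=> hE hA gE gA hg uA uh wA wg sh sg sA; apply/eqP; apply: contraT => uw.
have [m km L] := berge_tree_linked T uA wA uw.
have notE' (f : {set V}) : ~~ (f \subset A) -> f \notin E'.
  by apply: contra => /(berge_tree_edge T)[].
case: (linked_close Ef _ (linked_cons L (notE' _ hA) uh sh sA) _ gE _ sg wg).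
- by rewrite subUset sub1set hE.
- by clear -km; lia.
by rewrite in_setU1 negb_or eq_sym hg notE'.
Qed.

End Attach.

Lemma extremal_berge_tree E A :
  is_rgraph r E -> BC_free k E -> cover E \subset A -> 0 < #|A| ->
  r %| #|A| - 1 -> #|E| = berge_bound k r #|A| -> berge_tree k r A E.
Proof.
move: {2}#|A| (leqnn #|A|) => n.
elim: n E A => [|n IHn] E A An Er Ef EA A0 rA cE; first by lia.
have r0 : 0 < r by lia.
have [q Aq] : exists q, #|A| = q * r + 1 by case/dvdnP: rA => q; exists q; lia.
have bound_q p : berge_bound k r (p * r + 1) = p * (k - 1).
  by rewrite (@berge_boundE k r p 0) // (_ : (1 == r) = false); lia.
case: q Aq => [|q] Aq.
  move/eqP/cards1P: Aq => [x Ax]; rewrite Ax; move: cE.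
  rewrite Ax cards1 (bound_q 0) => /eqP; rewrite cards_eq0 => /eqP->; exact: BergeTreePoint.
have rltA : r < #|A| by rewrite Aq mulSn; lia.
have E0 : E != set0 by rewrite -card_gt0 cE Aq bound_q muln_gt0 subn_gt0 (ltn_trans _ k_ge4).
have [S SE S_small] := sparse_set Er Ef (ltnW (ltnW k_ge4)) k_lt_r E0.
have SA := subset_trans SE EA.
set E' := E :\: incident E S; have E'E : E' \subset E := subsetDl _ _.
have Er' := is_rgraph_sub E'E Er; have Ef' := BC_free_sub E'E Ef.
have EA' : cover E' \subset A :\: S.
  by apply: subset_trans (cover_remove E S) _; exact: setSD.
have := BC_free_upper_bound (ltnW k_ge4) k_lt_r Er' Ef' EA'.
have cEE := card_remove E S; rewrite -/E' in cEE.
rewrite cardsDS // => E'_le.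
case: S_small => -[Sr inc]; rewrite Sr in E'_le; last first.
  (* An extremal hypergraph has no slack to lose, so the alternative with [r.-1] vertices is
     impossible. *)
  have := @berge_bound_pred k r #|A| (ltnW k_ge4) k_lt_r rltA.
  rewrite rA -cE; move: E'_le inc; rewrite cEE.
  move: #|E'| #|incident E S| (berge_bound k r _) => a b c; clear; lia.
have Arq : #|A| - r = q * r + 1 by rewrite Aq mulSn; clear; lia.
rewrite Arq bound_q in E'_le; rewrite cE Aq bound_q mulSn in cEE.
have A'q : #|A :\: S| = q * r + 1 by rewrite cardsDS // Sr.
have T : berge_tree k r (A :\: S) E'.
  apply: IHn => //; rewrite ?A'q.
  - by move: An; rewrite Aq mulSn; move: (q * r) r0; clear; lia.
  - by rewrite addn1.
  - by rewrite addnK dvdn_mull.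
  rewrite bound_q; move: E'_le inc cEE.
  by move: #|E'| #|incident E S| (q * _) => a b c; clear; lia.
set F := incident E S in inc cEE *.
have Fk : #|F| = k - 1.
  by move: E'_le inc cEE; move: #|E'| #|F| (q * _) => a b c; clear; lia.
have FE h : h \in F -> h \in E by case/setIdP.
have FA h : h \in F -> ~~ (h \subset A :\: S).
  case/setIdP=> _; apply: contra => hA; rewrite disjoint_subset.
  by apply/subsetP => y /(subsetP hA)/setDP[].
have inA h y : h \in E -> y \in h -> y \in A.
  by move=> hE yh; apply: (subsetP EA); apply/bigcupP; exists h.
have FS h : h \in F -> r.-1 <= #|h :&: S|.
  move=> hF; rewrite -(card_rgraph Er (FE _ hF)) -(cardsID S h).
  suff : #|h :\: S| <= 1 by move: #|_ :\: _| #|_ :&: _| => a b; clear; lia.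
  apply/card_le1_eqP => u w /setDP[uh uS] /setDP[wh wS].
  apply: (attached_edge_point Ef T E'E (FE _ hF) (FA _ hF)) => //;
    by rewrite inE ?uS ?wS (inA h) // FE.
(* Two deleted hyperedges each have at least [r.-1] of the [r] vertices of [S], so they meet in [S],
   and this forces their outside vertices to coincide. If none leaves [S], any [x] will do. *)
have [x xA xF] : exists2 x, x \in A :\: S & forall h y, h \in F -> y \in h -> y \notin S -> y = x.
  have [[h [x [hF xh xS]]]|no] := classic (exists h x, [/\ h \in F, x \in h & x \notin S]).
    have xA : x \in A :\: S by rewrite inE xS (inA h) // FE.
    exists x => // g y gF yg yS; have yA : y \in A :\: S by rewrite inE yS (inA g) // FE.
    have [gh|gh] := eqVneq g h.
      rewrite gh in gF yg.
      exact: (attached_edge_point Ef T E'E (FE _ hF) (FA _ hF)).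
    have [s /setIP[/setIP[sg sS] /setIP[sh _]]] : exists s, s \in (g :&: S) :&: (h :&: S).
      apply/set0Pn; rewrite -card_gt0; have := cardsUI (g :&: S) (h :&: S).
      have := FS _ gF; have := FS _ hF.
      have : #|(g :&: S) :|: (h :&: S)| <= #|S| by apply: subset_leq_card; rewrite -setIUl subsetIr.
      rewrite Sr; move: #|_ :|: _| #|g :&: S| #|h :&: S| #|_ :&: _| k_ge4 k_lt_r.
      by clear => a b c d; lia.
    apply: (attached_edges_point Ef T E'E (FE _ gF) (FA _ gF) (FE _ hF) (FA _ hF) gh) sg sh _ => //.
    by rewrite inE sS.
  have /card_gt0P[x xA] : 0 < #|A :\: S| by rewrite A'q addn1.
  by exists x => // h y hF yh yS; case: no; exists h, y.
have -> : E = E' :|: F.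
  by rewrite setUC /E' -/F -{1}(setIidPr (_ : F \subset E)) ?setID //; apply/subsetP.
have {1}-> : A = (A :\: S) :|: S by rewrite setUC -{1}(setIidPr SA) setID.
apply: BergeTreeGlue T xA _ Sr Fk _.
  by rewrite disjoint_subset; apply/subsetP => y; rewrite !inE => /andP[].
move=> h hF; split; last exact: card_rgraph Er (FE _ hF).
apply/subsetP => y yh; have [yS|yS] := boolP (y \in S); first exact: setU1r.
by rewrite (xF _ _ hF yh yS) setU11.
Qed.

End BergeTree.
End BergeTrees.

(** * Connectivity of induced subgraphs *)

Section Connectivity.
Variable V : finType.
Implicit Types (g : rel V) (A B D X : {set V}) (x y u w : V).

Definition restrict_rel g A : rel V := [rel u w | [&& u \in A, w \in A & g u w]].

Lemma restrict_rel_sym g A : symmetric g -> connect_sym (restrict_rel g A).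
Proof. by move=> gsym; apply: sym_connect_sym => u w; rewrite /restrict_rel /= gsym andbCA. Qed.

Lemma connected_on_from g A b :
  symmetric g -> b \in A -> (forall y, y \in A -> connect (restrict_rel g A) b y) ->
  connected_on g A.
Proof.
move=> gsym bA conn; apply/andP; split; first by apply/set0Pn; exists b.
apply/forall_inP => x xA; apply/forall_inP => y yA.
apply: connect_trans (conn _ yA); rewrite -/(restrict_rel g A).
by rewrite restrict_rel_sym //; exact: conn.
Qed.

Lemma connected_on_connect g A x y :
  connected_on g A -> x \in A -> y \in A -> connect (restrict_rel g A) x y.
Proof. by case/andP=> _ /forall_inP conn xA yA; exact: (forall_inP (conn x xA)). Qed.

Lemma connect_restrict_sub g g' A B x y :
  A \subset B -> subrel g g' -> connect (restrict_rel g A) x y -> connect (restrict_rel g' B) x y.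
Proof.
move=> /subsetP AB gg'; apply: connect_sub => u w /and3P[uA wA uw].
by apply: connect1; rewrite /restrict_rel /= !AB // gg'.
Qed.

Lemma connected_onU g A B x :
  symmetric g -> connected_on g A -> connected_on g B -> x \in A -> x \in B ->
  connected_on g (A :|: B).
Proof.
move=> gsym cA cB xA xB; apply: (connected_on_from gsym (b := x)); first by rewrite inE xA.
move=> y /setUP[yA|yB].
  by apply: connect_restrict_sub (connected_on_connect cA xA yA) => //; exact: subsetUl.
by apply: connect_restrict_sub (connected_on_connect cB xB yB) => //; exact: subsetUr.
Qed.

Lemma connected_on_neighbor g A u :
  connected_on g A -> 1 < #|A| -> u \in A -> exists2 w, w \in A & g u w.
Proof.
move=> cA A1 uA; have [w] : exists w, w \in A :\ u.
  by apply/set0Pn; rewrite -card_gt0; move: A1; rewrite (cardsD1 u A) uA.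
case/setD1P=> wu wA; have /connectP[[|z p]] := connected_on_connect cA uA wA.
  by move=> _ wE; rewrite wE eqxx in wu.
by case/andP=> /and3P[_ zA uz] _ _; exists z.
Qed.

Lemma connected_on_sub g g' A : subrel g g' -> connected_on g A -> connected_on g' A.
Proof.
move=> gg' cA; have /andP[A0 _] := cA; apply/andP; split=> //.
apply/forall_inP => x xA; apply/forall_inP => y yA.
exact: connect_restrict_sub (connected_on_connect cA xA yA).
Qed.

Lemma two_connected_on_sub g g' A :
  subrel g g' -> two_connected_on g A -> two_connected_on g' A.
Proof.
move=> gg' /and3P[A2 cA /forall_inP cAx]; apply/and3P; split=> //.
  exact: connected_on_sub cA.
by apply/forall_inP => x /cAx; exact: connected_on_sub.
Qed.

Lemma eq_connected_on g g' A : {in A &, g =2 g'} -> connected_on g A = connected_on g' A.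
Proof.
move=> gg'; congr (_ && _); apply: eq_forallb_in => x xA; apply: eq_forallb_in => y yA.
by apply: eq_connect => u w /=; case: (boolP (u \in A)) => // uA; case: (boolP (w \in A)) => //= wA; exact: gg'.
Qed.

Lemma eq_two_connected_on g g' A :
  {in A &, g =2 g'} -> two_connected_on g A = two_connected_on g' A.
Proof.
move=> gg'; rewrite /two_connected_on (eq_connected_on gg'); congr [&& _, _ & _].
apply: eq_forallb_in => x xA; apply: eq_connected_on => u w /setD1P[_ uA] /setD1P[_ wA].
exact: gg'.
Qed.

Lemma connected_on_clique g A :
  symmetric g -> A != set0 -> {in A &, forall u w, u != w -> g u w} -> connected_on g A.
Proof.
move=> gsym /set0Pn[b bA] clique; apply: (connected_on_from gsym bA) => y yA.
by have [->|by_] := eqVneq b y; [exact: connect0 | apply: connect1; rewrite /restrict_rel /= bA yA clique].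
Qed.

Lemma two_connected_on_clique g A :
  symmetric g -> 2 < #|A| -> {in A &, forall u w, u != w -> g u w} -> two_connected_on g A.
Proof.
move=> gsym A2 clique; apply/and3P; split=> //.
  by apply: connected_on_clique => //; rewrite -card_gt0; apply: leq_trans A2.
apply/forall_inP => x xA; apply: connected_on_clique => //.
  by rewrite -card_gt0; move: A2; rewrite (cardsD1 x A) xA; exact: ltnW.
by move=> u w /setD1P[_ uA] /setD1P[_ wA]; exact: clique.
Qed.

Lemma connected_on_chain g A (f : nat -> {set V}) (z : nat -> V) t :
  symmetric g -> 0 < t -> A :&: f 0 != set0 ->
  (forall m, m < t -> {in f m &, forall u w, u != w -> g u w}) ->
  (forall m, m.+1 < t -> [/\ z m \in A, z m \in f m & z m \in f m.+1]) ->
  (forall u, u \in A -> exists2 m, m < t & u \in f m) ->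
  connected_on g A.
Proof.
move=> gsym t0 /set0Pn[b /setIP[bA bf]] clique zf Af.
have step m u w : m < t -> u \in A -> u \in f m -> w \in A -> w \in f m ->
    connect (restrict_rel g A) u w.
  move=> mt uA uf wA wf; have [->|uw] := eqVneq u w; first exact: connect0.
  by apply: connect1; rewrite /restrict_rel /= uA wA (clique m).
have conn m : m < t -> forall u, u \in A -> u \in f m -> connect (restrict_rel g A) b u.
  elim: m => [|m IHm] mt u uA uf; first exact: (step 0).
  have [zA zm zm1] := zf m mt.
  apply: connect_trans (IHm (ltnW mt) _ zA zm) _; exact: (step m.+1).
apply: (connected_on_from gsym bA) => u uA; have [m mt um] := Af u uA.
exact: (conn m).
Qed.

End Connectivity.

Lemma val_iter_ordS t (i : 'I_t) m : val (iter m (@ordS t) i) = (i + m) %% t.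
Proof.
elim: m => [|m IHm]; first by rewrite addn0 modn_small.
by rewrite /= IHm -addn1 modnDml addn1 addnS.
Qed.

Lemma iter_ordS_reach t (i j : 'I_t) : exists2 m, m < t & j = iter m (@ordS t) i.
Proof.
have t0 : 0 < t by apply: leq_ltn_trans (ltn_ord i).
exists ((j + (t - i)) %% t); first by rewrite ltn_mod.
apply: val_inj; rewrite val_iter_ordS modnDmr addnCA subnKC ?(ltnW (ltn_ord i)) //.
by rewrite modnDr modn_small.
Qed.

Lemma iter_ordS_neq t (i : 'I_t) m : 0 < m < t -> iter m (@ordS t) i != i.
Proof.
case/andP=> m0 mt; rewrite -val_eqE val_iter_ordS /=; have it := ltn_ord i.
have [lt|ge] := ltnP (i + m) t.
  by rewrite modn_small //; apply/eqP; lia.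
rewrite -(subnK ge) modnDr modn_small; last by lia.
by apply/eqP; lia.
Qed.

(** * Two-connected vertex sets of the shadow *)

Section TwoConnectedBlocks.
Variable V : finType.
Implicit Types (E F : {set {set V}}) (A B S X U h : {set V}) (x y u w : V).

Lemma shadow_sym E : symmetric (shadow E).
Proof.
by move=> u w; rewrite /shadow eq_sym; congr (_ && _); apply: eq_existsb => h; rewrite andbCA andbC -andbA [_ && (u \in h)]andbC.
Qed.

Lemma shadowP E u w :
  reflect (u != w /\ exists2 h, h \in E & u \in h /\ w \in h) (shadow E u w).
Proof.
apply: (iffP andP) => -[uw H]; split=> //.
  by have [h hE /andP[]] := exists_inP H; exists h.
by have [h hE [uh wh]] := H; apply/exists_inP; exists h; rewrite // uh wh.
Qed.

Lemma shadow_sub E F : E \subset F -> subrel (shadow E) (shadow F).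
Proof.
by move=> /subsetP EF u w /shadowP[uw [h /EF hF uwh]]; apply/shadowP; split=> //; exists h.
Qed.

Lemma shadow_clique E h : h \in E -> {in h &, forall u w, u != w -> shadow E u w}.
Proof. by move=> hE u w uh wh uw; apply/shadowP; split=> //; exists h. Qed.

Lemma two_connected_edge E h : h \in E -> 2 < #|h| -> two_connected_on (shadow E) h.
Proof.
move=> hE h2; apply: two_connected_on_clique => //; [exact: shadow_sym | exact: shadow_clique].
Qed.

(** The hyperedges are cliques arranged in a circle. Removing one vertex destroys at most one of the
    chosen joints, and the remaining ones still chain the cliques together. *)
Lemma berge_cycle_two_connected E t (v : {ffun 'I_t -> V}) (e : {ffun 'I_t -> {set V}}) :
  0 < t -> (forall h, h \in E -> 2 < #|h|) -> berge_cycle E v e ->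
  two_connected_on (shadow E) (\bigcup_i e i).
Proof.
move=> t0 E2 /and3P[/injectiveP vinj _ /forallP ve].
have eE i : e i \in E by have /and3P[] := ve i.
set U := \bigcup_i e i.
have eU i : e i \subset U by apply: bigcup_sup.
suff conn (D : {set V}) : #|D| <= 1 -> connected_on (shadow E) (U :\: D).
  apply/and3P; split.
  - by apply: leq_trans (subset_leq_card (eU (Ordinal t0))); exact: E2.
  - by rewrite -[U]setD0 conn ?cards0.
  by apply/forall_inP => x _; rewrite conn ?cards1.
move=> D1.
(* The chain starts at [e i0] and goes once around, so the only joint it never uses is [v i0]. *)
have [i0 i0P] : exists i0, forall i, i != i0 -> v i \notin D.
  have [/existsP[i0 vi0]|/existsPn no] := boolP [exists i, v i \in D]; last first.
    by exists (Ordinal t0) => i _; exact: no.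
  exists i0 => i; apply: contra => vi; apply/eqP/vinj.
  exact: (card_le1_eqP D1).
apply: (@connected_on_chain _ _ _ (fun m => e (iter m (@ordS t) i0))
  (fun m => v (iter m.+1 (@ordS t) i0)) t) => //.
- exact: shadow_sym.
- apply/set0Pn; have [y yD] : exists y, y \in e i0 :\: D.
    apply/set0Pn; rewrite -card_gt0 cardsD subn_gt0.
    apply: leq_ltn_trans (subset_leq_card (subsetIr _ _)) _.
    by apply: leq_ltn_trans D1 _; apply: ltnW; exact: E2.
  by exists y; move: yD; rewrite !inE => /andP[-> ye]; rewrite /= ye (subsetP (eU i0)).
- by move=> m mt; exact: shadow_clique.
- move=> m mt; set i := iter m _ _.
  have /and3P[_ _ vSi] := ve i; have /and3P[_ vi1 _] := ve (ordS i).
  split=> //; rewrite inE (subsetP (eU i)) // andbT.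
  by apply: i0P; exact: (@iter_ordS_neq t i0 m.+1).
move=> u /setDP[/bigcupP[j _ uj] _]; have [m mt jm] := iter_ordS_reach i0 j.
by exists m => //; rewrite -jm.
Qed.

Definition induced_edges E X : {set {set V}} := [set h in E | h \subset X].

(** A Berge cycle of length [t] puts [t] hyperedges into the 2-connected union of its hyperedges. *)
Lemma BC_free_of_sparse_subgraphs k E :
  0 < k ->
  (forall h, h \in E -> 2 < #|h|) ->
  (forall X, two_connected_on (shadow E) X -> #|induced_edges E X| < k) ->
  BC_free k E.
Proof.
move=> k0 E2 small; apply/BC_freeP => t v e kt cyc.
have t0 := leq_trans k0 kt.
have := small _ (berge_cycle_two_connected t0 E2 cyc).
have /and3P[_ /injectiveP einj /forallP ve] := cyc.
rewrite ltnNge (leq_trans kt) // -[leqLHS]card_ord -(card_imset _ einj).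
apply/subset_leq_card/subsetP => _ /imsetP[i _ ->].
by have /and3P[eE _ _] := ve i; rewrite inE eE bigcup_sup.
Qed.

(* E lives on A, F lives on x |: S, and x is the only common vertex, hence a
   cut vertex of the shadow of E :|: F. *)
Section Gluing.
Variables (E F : {set {set V}}) (A S : {set V}) (x : V).
Hypotheses (EA : forall h, h \in E -> h \subset A).
Hypotheses (FS : forall h, h \in F -> h \subset x |: S).
Hypotheses (xA : x \in A) (AS : [disjoint A & S]).

Lemma two_connected_glue X :
  two_connected_on (shadow (E :|: F)) X ->
  X \subset A /\ two_connected_on (shadow E) X \/ X \subset x |: S.
Proof.
move=> tX; have /and3P[X2 cX /forall_inP cXx] := tX.
have [|/subsetPn[a aX aS]] := boolP (X \subset x |: S); [by right | left].
have cXx' : connected_on (shadow (E :|: F)) (X :\ x).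
  have [/cXx//|xX] := boolP (x \in X).
  suff -> : X :\ x = X by [].
  by apply/setDidPl; rewrite disjoint_sym disjoints1.
have noS y : y \in X -> y \notin S.
  move=> yX; have [->|yx] := eqVneq y x; first by rewrite (disjointFr AS xA).
  have aX' : a \in X :\ x by rewrite in_setD1 aX andbT; apply: contra aS => /eqP->; exact: setU11.
  have yX' : y \in X :\ x by rewrite in_setD1 yx yX.
  have := connected_on_connect cXx' aX' yX'.
  (* Without [x], no step leaves the complement of [x |: S]; as [a] is in it, all of [X :\ x] is. *)
  have cl : closed (restrict_rel (shadow (E :|: F)) (X :\ x)) [pred z | z \notin x |: S].
    apply: intro_closed; first exact/restrict_rel_sym/shadow_sym.
    move=> u w /and3P[_ /setD1P[wx _] /shadowP[_ [h hEF [uh wh]]]].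
    rewrite !inE negb_or => /andP[ux uS]; rewrite (negPf wx) /=.
    case/setUP: hEF => [/EA hA|/FS hS]; first by rewrite (disjointFr AS (subsetP hA _ wh)).
    by have := subsetP hS _ uh; rewrite !inE (negPf ux) (negPf uS).
  move/(closed_connect cl); rewrite [a \in _]aS => /esym yxS.
  by apply: contra (yxS : y \notin x |: S); exact: setU1r.
have XA : X \subset A.
  apply/subsetP => u uX; have [w wX] := connected_on_neighbor cX (ltnW X2) uX.
  case/shadowP=> uw [h /setUP[/EA hA|/FS hS] [uh wh]]; first exact: (subsetP hA).
  have := subsetP hS _ uh; have := subsetP hS _ wh.
  by rewrite !in_setU1 (negPf (noS _ uX)) (negPf (noS _ wX)) !orbF => /eqP wx; rewrite wx in uw; rewrite (negPf uw).
split; first exact: XA.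
rewrite (eq_two_connected_on (g' := shadow (E :|: F))); first exact: tX.
move=> u w uX wX.
apply/idP/idP; first by apply: shadow_sub; exact: subsetUl.
case/shadowP=> uw [h /setUP[hE uwh|/FS hS [uh wh]]]; first by apply/shadowP; split=> //; exists h.
have := subsetP hS _ uh; have := subsetP hS _ wh.
by rewrite !in_setU1 (negPf (noS _ uX)) (negPf (noS _ wX)) !orbF => /eqP wx; rewrite wx in uw; rewrite (negPf uw).
Qed.

End Gluing.
End TwoConnectedBlocks.

(** * Berge trees compared with block trees, and the extremal construction *)

Section BlockTree.
Variable V : finType.
Implicit Types (E F : {set {set V}}) (A B S X U h : {set V}) (x y u w : V).
Variables (k r : nat).
Hypotheses (k_ge4 : 4 <= k) (k_lt_r : k < r).

Lemma induced_edges_glue E F A S (x : V) B :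
  berge_tree k r A E -> [disjoint A & S] ->
  (forall h, h \in F -> h \subset x |: S /\ #|h| = r) ->
  B \subset A -> induced_edges (E :|: F) B = induced_edges E B.
Proof.
move=> T AS FS BA; apply/setP => h; rewrite !inE.
case: (boolP (h \in E)) => //= _; apply/negP => /andP[hF hB].
by have := glue_edge_notin k_ge4 k_lt_r AS FS hF; rewrite (subset_trans hB BA).
Qed.

Lemma edge_notin_glued_block E A S (x : V) h :
  berge_tree k r A E -> [disjoint A & S] -> h \in E -> ~~ (h \subset x |: S).
Proof.
move=> T AS hE; have [hA hr] := berge_tree_edge T hE.
apply/negP => hS; have : h \subset [set x].
  apply/subsetP => y yh; have /setU1P[->|yS] := subsetP hS _ yh; first by rewrite inE.
  by rewrite (disjointFr AS (subsetP hA _ yh)) in yS.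
by move/subset_leq_card; rewrite cards1 hr leqNgt (ltn_trans _ (ltn_trans k_ge4 k_lt_r)).
Qed.

(** Each gluing vertex is a cut vertex, so a 2-connected set falls into one glued block, and later
    gluings add no hyperedge inside that block. *)
Lemma berge_tree_block A E X :
  berge_tree k r A E -> two_connected_on (shadow E) X ->
  exists B, [/\ X \subset B, B \subset A, two_connected_on (shadow E) B,
                #|B| = r.+1 & #|induced_edges E B| = k - 1].
Proof.
move=> T; elim: {A E} T X => [x|A E x S F T IH xA AS Sr Fk FS] X tX.
  have /and3P[X2 cX _] := tX; have /card_gt0P[u uX] := ltnW (ltnW X2).
  have [w _ /shadowP[_ [h]]] := connected_on_neighbor cX (ltnW X2) uX.
  by rewrite inE.
have EA h : h \in E -> h \subset A by case/(berge_tree_edge T).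
have FS' h : h \in F -> h \subset x |: S by case/FS.
case: (two_connected_glue EA FS' xA AS tX) => [[_ tXE]|XS].
  have [B [XB BA tB Br Bk]] := IH X tXE; exists B; split.
  - exact: XB.
  - exact: subset_trans BA (subsetUl _ _).
  - by apply: two_connected_on_sub tB; apply: shadow_sub; exact: subsetUl.
  - exact: Br.
  by rewrite (induced_edges_glue T AS FS BA).
have cB := card_glue_block xA AS Sr.
exists (x |: S); split.
- exact: XS.
- by rewrite subUset sub1set inE xA subsetUr.
- apply: two_connected_on_clique; first exact: shadow_sym.
    by rewrite cB ltnS (ltn_trans _ (ltn_trans k_ge4 k_lt_r)).
  move=> u w uB wB uw.
  have [h hF uwh] := block_edge_through cB k_ge4 k_lt_r FS Fk uB wB.
  by apply/shadowP; split=> //; exists h; rewrite // inE hF orbT.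
- exact: cB.
rewrite -Fk; apply: eq_card => h; rewrite !inE.
have [hE|hE] /= := boolP (h \in E); last by apply/andb_idr => /FS'.
rewrite (negPf (edge_notin_glued_block x T AS hE)); apply/esym/negP => /FS'.
by rewrite (negPf (edge_notin_glued_block x T AS hE)).
Qed.

Lemma berge_tree_connected A E :
  berge_tree k r A E -> connected_on (shadow E) A.
Proof.
elim=> {A E} [x|A E x S F T cA xA AS Sr Fk FS].
  apply: connected_on_clique; first exact: shadow_sym.
    by apply/set0Pn; exists x; rewrite inE.
  by move=> u w /set1P-> /set1P->; rewrite eqxx.
have -> : A :|: S = A :|: (x |: S).
  by rewrite setUA; congr (_ :|: _); apply/esym/setUidPl; rewrite sub1set.
apply: (connected_onU (x := x)); first exact: shadow_sym.
- by apply: connected_on_sub cA; apply: shadow_sub; exact: subsetUl.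
- apply: connected_on_clique; first exact: shadow_sym.
    by apply/set0Pn; exists x; rewrite setU11.
  move=> u w uB wB uw; have cB := card_glue_block xA AS Sr.
  have [h hF uwh] := block_edge_through cB k_ge4 k_lt_r FS Fk uB wB.
  by apply/shadowP; split=> //; exists h; rewrite // inE hF orbT.
- exact: xA.
exact: setU11.
Qed.

Lemma berge_tree_block_tree E :
  berge_tree k r setT E -> block_tree r (r + 1) (k - 1) E.
Proof.
move=> T; apply/and3P; split.
- by apply/forall_inP => h /(berge_tree_edge T)[_ ->].
- exact: berge_tree_connected.
apply/forall_inP => X mX; have [B [XB _ tB Br Bk]] := berge_tree_block T (maxsetp mX).
by rewrite -(maxsetsup mX tB XB) Br addn1 eqxx -Bk /= eqxx.
Qed.

Lemma rgraph_card_gt2 E h : is_rgraph r E -> h \in E -> 2 < #|h|.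
Proof.
by move=> Er /(card_rgraph Er)->; exact: ltn_trans (ltn_trans k_ge4 k_lt_r).
Qed.

Lemma induced_edges_sub E X B :
  X \subset B -> induced_edges E X \subset induced_edges E B.
Proof.
by move=> XB; apply/subsetP => h; rewrite !inE => /andP[-> hX]; exact: subset_trans XB.
Qed.

Lemma block_tree_BC_free E : block_tree r (r + 1) (k - 1) E -> BC_free k E.
Proof.
case/and3P=> Er _ /forall_inP blocks.
apply: BC_free_of_sparse_subgraphs => [|h|X tX]; first exact: ltn_trans k_ge4.
  exact: rgraph_card_gt2.
have [B mB XB] := maxset_exists tX.
have /andP[_ /eqP Bk] := blocks B mB.
apply: leq_ltn_trans (subset_leq_card (induced_edges_sub E XB)) _.
by rewrite Bk subn1 prednK // (ltn_trans _ k_ge4).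
Qed.

Lemma connected_on_exit (g : rel V) A :
  symmetric g -> connected_on g setT -> A != set0 -> A != setT ->
  exists x y, [/\ x \in A, y \notin A & g x y].
Proof.
move=> gsym cT /set0Pn[a aA] AT; have /subsetPn[b _ bA] : ~~ (setT \subset A) by rewrite subTset.
apply: NNPP => no; have cl : closed (restrict_rel g setT) (mem A).
  apply: intro_closed; first exact: restrict_rel_sym.
  move=> u w /and3P[_ _ uw] uA; apply: contraT => wA; case: no.
  by exists u, w.
by have := closed_connect cl (connected_on_connect cT (in_setT a) (in_setT b)); rewrite aA (negPf bA).
Qed.

(* A maximal Berge tree inside E spans: a block leaving it and meeting it twice
   would close a long Berge cycle. *)
Lemma block_tree_berge_tree E :
  block_tree r (r + 1) (k - 1) E ->
  exists2 E' : {set {set V}}, E' \subset E & berge_tree k r setT E'.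
Proof.
move=> bT; have Ef := block_tree_BC_free bT; case/and3P: bT => Er cT /forall_inP blocks.
have /andP[/set0Pn[x0 _] _] := cT.
have [||m [A [E' [E'E T Am]]] mmax] := @exists_max
  (fun m => exists (A : {set V}) (E' : {set {set V}}), [/\ E' \subset E, berge_tree k r A E' & #|A| = m]) #|V| 1.
- exists [set x0], set0; split; [exact: sub0set | exact: BergeTreePoint | exact: cards1].
- by move=> _ [A [E' [_ _ <-]]]; exact: max_card.
have [AT|AT] := eqVneq A setT; first by exists E'; rewrite -?AT.
have A0 : A != set0 by have [q [Aq _]] := berge_tree_card k_ge4 k_lt_r T; rewrite -card_gt0 Aq addn1.
have [x [y [xA yA /shadowP[xy [h0 h0E [xh0 yh0]]]]]] := connected_on_exit (@shadow_sym _ E) cT A0 AT.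
have [B mB h0B] := maxset_exists (two_connected_edge h0E (rgraph_card_gt2 Er h0E)).
have /andP[/eqP Br /eqP Fk] := blocks B mB; rewrite addn1 in Br.
set F := [set e in E | e \subset B] in Fk.
have FB h : h \in F -> h \subset B /\ #|h| = r.
  by case/setIdP=> hE hB; split=> //; exact: card_rgraph Er hE.
have FE h : h \in F -> h \in E by case/setIdP.
have [xB yB] := (subsetP h0B _ xh0, subsetP h0B _ yh0).
have notA h : y \in h -> ~~ (h \subset A) by move=> yh; apply/subsetPn; exists y.
(* Hyperedges of the block join [y], outside [A], to [x] and to [z]: either one of them meets [A]
   twice, or two different ones meet in [y]. *)
have ABx z : z \in A -> z \in B -> z = x.
  move=> zA zB; apply/eqP; apply: contraT => zx.
  have [h hF [xh yh]] := block_edge_through Br k_ge4 k_lt_r FB Fk xB yB.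
  have [g gF [zg yg]] := block_edge_through Br k_ge4 k_lt_r FB Fk zB yB.
  have [zh|zh] := boolP (z \in h).
    by have := attached_edge_point k_ge4 k_lt_r Ef T E'E (FE _ hF) (notA _ yh) zA zh xA xh; move/eqP; rewrite (negPf zx).
  have gh : g != h by apply: contraNneq zh => <-.
  have := attached_edges_point k_ge4 k_lt_r Ef T E'E (FE _ gF) (notA _ yg) (FE _ hF) (notA _ yh) gh zA zg xA xh yg yh yA.
  by move/eqP; rewrite (negPf zx).
have Sr : #|B :\ x| = r by have := cardsD1 x B; rewrite xB Br add1n => -[].
have AS : [disjoint A & B :\ x].
  rewrite disjoint_subset; apply/subsetP => z zA; rewrite !inE negb_and negbK.
  by have [/(ABx z zA)->|] := boolP (z \in B); rewrite ?eqxx ?orbT.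
have T' : berge_tree k r (A :|: B :\ x) (E' :|: F).
  by apply: BergeTreeGlue T xA AS Sr Fk _; rewrite setD1K.
have := mmax #|A :|: B :\ x|; rewrite cardsU disjoint_setI0 // cards0 subn0 Sr Am.
rewrite -[leqRHS]addn0 leq_add2l leqn0 => H; have /eqP r0 : r == 0.
  apply: H; exists (A :|: B :\ x), (E' :|: F); split=> //.
    by rewrite subUset E'E; apply/subsetP.
  by rewrite cardsU disjoint_setI0 // cards0 subn0 Sr Am.
by move: k_lt_r; rewrite r0.
Qed.

Lemma berge_tree_exists q :
  q * r + 1 <= #|V| -> exists (A : {set V}) (E : {set {set V}}), berge_tree k r A E /\ #|A| = q * r + 1.
Proof.
elim: q => [|q IHq] qV.
  have /card_gt0P[x _] : 0 < #|V| by [].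
  by exists [set x], set0; rewrite cards1; split=> //; exact: BergeTreePoint.
have [|A [E [T Aq]]] := IHq; first by apply: leq_trans qV; rewrite leq_add2r mulSn leq_addl.
have /card_gt0P[x xA] : 0 < #|A| by rewrite Aq addn1.
have [|S SA Sr] := @exists_subset_card _ (~: A) r.
  by have := cardsC A; rewrite Aq; move: qV; rewrite mulSn; move: #|~: A| #|V| (q * r) => a b c; clear; lia.
have AS : [disjoint A & S].
  by rewrite disjoint_sym disjoints_subset.
have cB := card_glue_block xA AS Sr.
have [|F FB Fk] := @exists_subset_card _ [set (x |: S) :\ u | u in x |: S] (k - 1).
  rewrite card_in_imset ?cB; first by move: k_lt_r; clear; lia.
  move=> u w uB wB eqD; apply/eqP; apply: contraT => uw.
  by have := setD11 u (x |: S); rewrite eqD in_setD1 uw uB.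
exists (A :|: S), (E :|: F); split.
  apply: BergeTreeGlue T xA AS Sr Fk _ => h /(subsetP FB)/imsetP[u uB ->].
  by split; [exact: subsetDl | have := cardsD1 u (x |: S); rewrite uB cB add1n => -[]].
by rewrite cardsU disjoint_setI0 // cards0 subn0 Aq Sr mulSn; clear; lia.
Qed.

Lemma berge_tree_sparse A E X :
  berge_tree k r A E -> two_connected_on (shadow E) X -> #|induced_edges E X| < k.
Proof.
move=> T /(berge_tree_block T)[B [XB _ _ _ Bk]].
apply: leq_ltn_trans (subset_leq_card (induced_edges_sub E XB)) _.
by rewrite Bk subn1 prednK // (ltn_trans _ k_ge4).
Qed.

Lemma berge_tree_BC_free A E : berge_tree k r A E -> BC_free k E.
Proof.
move=> T; apply: BC_free_of_sparse_subgraphs => [|h|X]; first exact: ltn_trans k_ge4.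
  by case/(berge_tree_edge T) => _ ->; exact: ltn_trans (ltn_trans k_ge4 k_lt_r).
exact: (berge_tree_sparse T).
Qed.

(** A Berge tree on q r + 1 vertices leaves s vertices over. When s = r - 1, they form one more
    hyperedge together with a vertex of the tree, which accounts for the indicator. *)
Lemma berge_bound_attained :
  0 < #|V| -> exists E : {set {set V}}, [/\ is_rgraph r E, BC_free k E & #|E| = berge_bound k r #|V|].
Proof.
move=> V0; have r0 : 0 < r by exact: leq_ltn_trans k_lt_r.
have [q [s [sr Vq]]] := pos_decomp r0 V0.
have [|A [E [T Aq]]] := @berge_tree_exists q; first by rewrite Vq leq_add2l.
have [q' [Aq' Eq]] := berge_tree_card k_ge4 k_lt_r T.
have {q' Aq'} Eq : #|E| = q * (k - 1).
  rewrite Eq; congr (_ * _); apply/eqP; rewrite -(eqn_pmul2r r0) -(eqn_add2r 1).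
  by rewrite -Aq -Aq'.
have Er : is_rgraph r E by apply/forall_inP => h /(berge_tree_edge T)[_ ->].
rewrite Vq berge_boundE //; have [sr'|sr'] := eqVneq s.+1 r; last first.
  by exists E; rewrite Eq addn0; split=> //; exact: berge_tree_BC_free T.
have /card_gt0P[x xA] : 0 < #|A| by rewrite Aq addn1.
have AS : [disjoint A & ~: A] by rewrite disjoints_subset setCK.
have Sr : #|~: A| = s.
  by have := cardsC A; rewrite Aq Vq; move: #|~: A| (q * r) => a b; clear; lia.
have hr : #|x |: ~: A| = r by rewrite cardsU1 inE xA Sr add1n.
have hA : ~~ (x |: ~: A \subset A).
  have : 0 < #|~: A| by rewrite Sr; move: k_ge4 k_lt_r sr'; clear; lia.
  case/card_gt0P=> z zA; apply/subsetPn; exists z; first exact: setU1r.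
  by rewrite inE in zA.
have hE : x |: ~: A \notin E by apply: contra hA => /(berge_tree_edge T)[].
have EhE : E :|: [set x |: ~: A] = (x |: ~: A) |: E by rewrite setUC.
exists (E :|: [set x |: ~: A]); split; last by rewrite EhE cardsU1 hE Eq addnC.
  by apply/forall_inP => h /setUP[/(card_rgraph Er)->|/set1P->]; rewrite ?hr.
apply: BC_free_of_sparse_subgraphs => [|h|X tX]; first exact: ltn_trans k_ge4.
  rewrite inE => /orP[/(rgraph_card_gt2 Er)//|/set1P->].
  by rewrite hr; exact: ltn_trans (ltn_trans k_ge4 k_lt_r).
have EA h : h \in E -> h \subset A by case/(berge_tree_edge T).
have FS h : h \in [set x |: ~: A] -> h \subset x |: ~: A by move/set1P->.
case: (two_connected_glue EA FS xA AS tX) => [[XA tXE]|XS].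
  apply: leq_ltn_trans (berge_tree_sparse T tXE).
  apply/subset_leq_card/subsetP => h; rewrite !inE => /andP[/orP[->//|/eqP->] hX].
  by rewrite (subset_trans hX XA) in hA.
(* Inside [x |: ~: A] the added hyperedge is alone, since those of the tree lie in [A]. *)
apply: (@leq_ltn_trans 1); last exact: ltn_trans k_ge4.
rewrite -(cards1 (x |: ~: A)); apply/subset_leq_card/subsetP => h.
rewrite inE => /andP[/setUP[hE'|//] hX].
by have := edge_notin_glued_block x T AS hE'; rewrite (subset_trans hX XS).
Qed.

End BlockTree.

Theorem theorem9 (k n r : nat) (k_gt0 : 0 < k) (n_gt0 : 0 < n) (r_gt0 : 0 < r)
    (k_ge4 : 4 <= k) (k_lt_r : k < r) :
  ex_uniform r n (BC_free k) = (n - 1) %/ r * (k - 1) + ind_pos_multiple r n /\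
  (r %| n - 1 ->
   forall (V : finType) (E : {set {set V}}), #|V| = n -> is_rgraph r E ->
     (BC_free k E /\ #|E| = ex_uniform r n (BC_free k)) <->
     block_tree r (r + 1) (k - 1) E).
Proof.
have exE : ex_uniform r n (BC_free k) = berge_bound k r n.
  apply/eqP; rewrite eqn_leq; apply/andP; split.
    apply/bigmax_leqP => E /andP[Er Ef]; rewrite -[n in leqRHS]card_ord -cardsT.
    by apply: BC_free_upper_bound => //; exact: ltnW.
  have [|E [Er Ef Eb]] := @berge_bound_attained 'I_n k r k_ge4 k_lt_r; first by rewrite card_ord.
  by rewrite card_ord in Eb; rewrite -Eb; apply: leq_bigmax_cond; rewrite Er.
split=> // rn V E Vn Er; rewrite exE; split=> [[Ef Eb]|bT].
  apply: berge_tree_block_tree => //.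
  by apply: extremal_berge_tree; rewrite ?cardsT ?Vn.
have Ef := block_tree_BC_free k_ge4 k_lt_r bT; split=> //.
apply/eqP; rewrite eqn_leq -Vn -cardsT BC_free_upper_bound ?(ltnW k_ge4) ?subsetT //.
(* The spanning Berge tree is only known to be contained in [E], but it already has as many
   hyperedges as the bound allows. *)
have [E' E'E T] := block_tree_berge_tree k_ge4 k_lt_r bT.
have [q [Vq E'q]] := berge_tree_card k_ge4 k_lt_r T.
by rewrite Vq berge_boundE ?(ltn_trans _ k_lt_r) // (_ : (1 == r) = false) ?addn0 -?E'q ?subset_leq_card //; move: k_ge4 k_lt_r; clear; lia.
Qed.
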